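(* Let $N\ge 2$, let $T=[0,1,\ldots,N]$ be a (nondegenerate) $N$-simplex realized with vertices $v_0,\ldots,v_N\in\mathbb{R}^N$, with duality structure determined by a center $C_T\in\mathbb{R}^N$, and let $K^*(T)$ be its Laplacian determinant. For $i\neq j$ let $$n_{ij}=\frac{\ell^*_{ij}}{\ell_{ij}}(v_j-v_i),\qquad n_i=\sum_{j\ne i}n_{ij},$$ let $T^{\#}$ be the dual simplex determined by the normals $n_0,\ldots,n_N$, and let $\widehat{n}$ be the $N\times N$ matrix with columns $n_1,\ldots,n_N$. Then the following hold. (a) $$K^*(T)=\frac{(-1)^N\det(\widehat{n})}{N!\,\operatorname{Vol}(T)}.$$ (b) $$K^*(T)=\frac{N^N\,\operatorname{Vol}(T^{\#})^{N-1}}{(N!)^2\operatorname{Vol}(T)}.$$ (c) Let $A_{\widehat{i}}$ be the $(N-1)$-dimensional volume of the face $\sigma_{\widehat{i}}$ of $T$ opposite vertex $i$, let $A_{j,\widehat{i}}$ be the signed volume of the piece of $\sigma_{\widehat{i}}$ associated to vertex $j$, and let $A$ be the $(N+1)\times(N+1)$ matrix whose $ij$-th entry is $A_{j,\widehat{i}}$ ($0\le i,j\le N$). Then $$K^*(T)=\frac{(-1)^N N^N\,\operatorname{Vol}(T)^{N-2}\det(A)}{(N!)^2\prod_{i=0}^N A_{\widehat{i}}}.$$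
   Context: Signed volume. The simplex with ordered vertices $w_0,\ldots,w_N\in\mathbb{R}^N$ (column vectors) has signed volume $$\operatorname{Vol}=\frac{(-1)^N}{N!}\det\begin{bmatrix} w_0 &\cdots & w_N\\ 1&\cdots&1\end{bmatrix},$$ where the ordering of the vertices determines the sign. Here $\operatorname{Vol}(T)$ and $\operatorname{Vol}(T^{\#})$ denote signed volumes in this sense. Duality structure. A subsimplex $\sigma=[i_0,\ldots,i_m]$ of $T$ is realized as the convex hull of $v_{i_0},\ldots,v_{i_m}$. Given the center $C_T\in\mathbb{R}^N$, for each subsimplex $\sigma\subset T$ of dimension at least one let $C_\sigma$ be the orthogonal projection of $C_T$ onto the affine span of $\sigma$. For nested subsimplices $\tau\subset\sigma$ with $\dim\sigma=\dim\tau+1$ and $\dim\tau\ge1$, the dual length is the signed distance $$\ell^*(\tau\subset\sigma)=\pm\|C_\sigma-C_\tau\|,$$ which is positive when $C_\sigma$ lies on the same side of the affine span of $\tau$ (inside the affine span of $\sigma$) as $\sigma$, and negative on the opposite side. For an edge $[i,j]$, $\ell_{ij}=\|v_j-v_i\|$, and $$\ell([i]\subset[i,j])=\frac{(C_{[i,j]}-v_i)\cdot(v_j-v_i)}{\|v_j-v_i\|}$$ is the signed length of the part of the edge associated to vertex $i$. Dual volumes of edges. For an edge $[i,j]$ contained in a subsimplex $\sigma$ of dimension $m\ge1$, its signed $(m-1)$-dimensional dual volume in $\sigma$ is $$\ell^*([i,j]\subset\sigma)=\frac{1}{(m-1)!}\sum_{[i,j]=\sigma_1\subset\sigma_2\subset\cdots\subset\sigma_m=\sigma}\;\prod_{r=1}^{m-1}\ell^*(\sigma_r\subset\sigma_{r+1}),$$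 the sum being over all chains of subsimplices with $\dim\sigma_r=r$ (for $m=1$ this equals $1$; for $m=2$ it is the dual length). Write $\ell^*_{ij}=\ell^*([i,j]\subset T)$. Laplacian determinant. The Laplacian matrix $L$ of $T$ is the $(N+1)\times(N+1)$ matrix, indexed by $0,\ldots,N$, with $L_{ij}=\ell^*_{ij}/\ell_{ij}$ for $i\ne j$ and $L_{ii}=-\sum_{j\ne i}\ell^*_{ij}/\ell_{ij}$. The Laplacian determinant is $K^*(T)=\det(-\widehat{L}_{00})$, where $\widehat{L}_{00}$ is $L$ with the first row and first column (index $0$) removed. No sign assumption is made on the weights. Dual simplex $T^{\#}$. One has $\sum_i n_i=0$. $T^{\#}$ is the $N$-simplex in $\mathbb{R}^N$, determined up to translation, with vertices $u_0,\ldots,u_N$ such that for each $i$, $n_i$ is an outward pointing normal to the face opposite $u_i$, with length equal to the $(N-1)$-dimensional volume of that face. If $n_1,\ldots,n_N$ are linearly dependent, $T^{\#}$ is called degenerate and $\operatorname{Vol}(T^{\#})=0$. Vertex pieces of faces. $\sigma_{\widehat{i}}=[0,\ldots,\widehat{i},\ldots,N]$ is the face of $T$ omitting vertex $i$. For $i\neq j$, $$A_{j,\widehat{i}}=\frac{1}{N-1}\sum_{k\ne i,j}\ell([j]\subset[j,k])\,\ell^*([j,k]\subset\sigma_{\widehat{i}}),$$ and $A_{i,\widehat{i}}=0$ for all $i$.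
   Formalization: The right-hand side of (b) is multiplied by sgn(Vol(T^#))^N and that of (c) by sgn(Vol(T))^N: as printed, (b) and (c) have the wrong sign for odd N when the respective signed volume is negative (unless K^*(T)=0). *)

(* Defs.v *)
From HB Require Import structures.
From mathcomp Require Import all_boot all_order all_algebra.
From mathcomp Require Import boolp classical_sets reals.

Set Implicit Arguments.
Unset Strict Implicit.
Unset Printing Implicit Defensive.

Import Order.TTheory GRing.Theory Num.Theory.
Local Open Scope ring_scope.

Definition dotv (R : realType) (N : nat) (x y : 'cV[R]_N) : R :=
  (x^T *m y) ord0 ord0.

(* The Euclidean norm; the norm that the libraries put on matrices is the
   maximum norm. *)
Definition enorm (R : realType) (N : nat) (x : 'cV[R]_N) : R :=
  Num.sqrt (dotv x x).

Definition affinely_independent (R : realType) (N : nat)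
    (v : 'I_N.+1 -> 'cV[R]_N) : Prop :=
  forall c : 'I_N.+1 -> R,
    \sum_i c i = 0 -> \sum_i c i *: v i = 0 -> forall i, c i = 0.

(* The last row of the matrix is (1 ... 1). *)
Definition signed_volume (R : realType) (N : nat)
    (w : 'I_N.+1 -> 'cV[R]_N) : R :=
  (-1) ^+ N / N`!%:R *
  \det (\matrix_(k < N.+1, j < N.+1)
          (if unlift ord_max k is Some l then w j l ord0 else 1)).

(* Subsimplices are represented by their sets of vertex indices. *)
Definition dim (N : nat) (s : {set 'I_N.+1}) : nat := #|s|.-1.

(* The unsigned m-dimensional volume, m = dim s, through the Gram determinant
   of the m edge vectors (the rows of E) issued from the first vertex of s. *)
Definition subsimplex_volume (R : realType) (N : nat)
    (v : 'I_N.+1 -> 'cV[R]_N) (s : {set 'I_N.+1}) : R :=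
  let vertex k := v (nth ord0 (enum s) k) in
  let E := \matrix_(k < dim s, l < N) (vertex k.+1 - vertex 0%N) l ord0 in
  Num.sqrt (\det (E *m E^T)) / (dim s)`!%:R.

Definition affine_span (R : realType) (N : nat)
    (v : 'I_N.+1 -> 'cV[R]_N) (s : {set 'I_N.+1}) : set 'cV[R]_N :=
  [set p | exists c : 'I_N.+1 -> R,
     \sum_(i in s) c i = 1 /\ p = \sum_(i in s) c i *: v i]%classic.

Definition is_orthogonal_projection (R : realType) (N : nat)
    (H : set 'cV[R]_N) (x p : 'cV[R]_N) : Prop :=
  H p /\ forall q, H q -> dotv (x - p) (q - p) = 0.

Definition subsimplex_center (R : realType) (N : nat) (v : 'I_N.+1 -> 'cV[R]_N)
    (C : 'cV[R]_N) (s : {set 'I_N.+1}) : 'cV[R]_N :=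
  xget 0 [set p | is_orthogonal_projection (affine_span v s) C p]%classic.

(* H is used as a hyperplane of an ambient flat containing p and q: the
   segment from p to q does not meet H. *)
Definition same_side (R : realType) (N : nat) (H : set 'cV[R]_N)
    (p q : 'cV[R]_N) : Prop :=
  forall a : R, 0 <= a <= 1 -> ~ H (p + a *: (q - p)).

(* For t a facet of s, s lies on the side of its only vertex outside t. When
   the center of s lies in the affine span of t, the distance is zero. *)
Definition dual_length (R : realType) (N : nat) (v : 'I_N.+1 -> 'cV[R]_N)
    (C : 'cV[R]_N) (t s : {set 'I_N.+1}) : R :=
  let d := enorm (subsimplex_center v C s - subsimplex_center v C t) in
  if `[< forall k, k \in s :\: t ->
           same_side (affine_span v t) (subsimplex_center v C s) (v k) >]
  then d else - d.

Definition edge_length (R : realType) (N : nat) (v : 'I_N.+1 -> 'cV[R]_N)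
    (i j : 'I_N.+1) : R :=
  enorm (v j - v i).

Definition half_edge_length (R : realType) (N : nat)
    (v : 'I_N.+1 -> 'cV[R]_N) (C : 'cV[R]_N) (i j : 'I_N.+1) : R :=
  dotv (subsimplex_center v C [set i; j] - v i) (v j - v i) / enorm (v j - v i).

(* Sequences are indexed from 0, so the entry of index r has dimension r + 1. *)
Definition is_chain (N : nat) (i j : 'I_N.+1) (s : {set 'I_N.+1}) (m : nat)
    (c : m.-tuple {set 'I_N.+1}) : bool :=
  [&& head finset.set0 c == [set i; j],
      last finset.set0 c == s,
      sorted (fun t u : {set 'I_N.+1} => t \subset u) c
    & [forall r : 'I_m, dim (tnth c r) == r.+1]].

Definition dual_volume (R : realType) (N : nat) (v : 'I_N.+1 -> 'cV[R]_N)
    (C : 'cV[R]_N) (i j : 'I_N.+1) (s : {set 'I_N.+1}) : R :=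
  ((dim s).-1`!%:R)^-1 *
  \sum_(c : (dim s).-tuple {set 'I_N.+1} | is_chain i j s c)
    \prod_(r < (dim s).-1)
      dual_length v C (nth finset.set0 c r) (nth finset.set0 c r.+1).

Definition weight (R : realType) (N : nat) (v : 'I_N.+1 -> 'cV[R]_N)
    (C : 'cV[R]_N) (i j : 'I_N.+1) : R :=
  dual_volume v C i j [set: 'I_N.+1] / edge_length v i j.

Definition laplacian (R : realType) (N : nat) (v : 'I_N.+1 -> 'cV[R]_N)
    (C : 'cV[R]_N) : 'M[R]_N.+1 :=
  \matrix_(i, j) (if i == j then - \sum_(k | k != i) weight v C i k
                  else weight v C i j).

Definition laplacian_determinant (R : realType) (N : nat)
    (v : 'I_N.+1 -> 'cV[R]_N) (C : 'cV[R]_N) : R :=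
  \det (- row' ord0 (col' ord0 (laplacian v C))).

Definition vertex_normal (R : realType) (N : nat) (v : 'I_N.+1 -> 'cV[R]_N)
    (C : 'cV[R]_N) (i : 'I_N.+1) : 'cV[R]_N :=
  \sum_(j | j != i) weight v C i j *: (v j - v i).

(* The columns are n 1, ..., n N; n 0 is omitted. *)
Definition normal_matrix (R : realType) (N : nat)
    (n : 'I_N.+1 -> 'cV[R]_N) : 'M[R]_N :=
  \matrix_(k, j) n (lift ord0 j) k ord0.

Definition is_dual_simplex (R : realType) (N : nat)
    (n u : 'I_N.+1 -> 'cV[R]_N) : Prop :=
  affinely_independent u /\
  forall i,
    [/\ forall j k, j != i -> k != i -> dotv (n i) (u k - u j) = 0,
        forall j, j != i -> 0 < dotv (n i) (u j - u i)
      & enorm (n i) = subsimplex_volume u [set~ i]].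

(* A dual simplex is unique up to translation, so its signed volume does not
   depend on the choice of u; row_free expresses the linear independence of
   n 1, ..., n N. *)
Definition dual_simplex_volume (R : realType) (N : nat)
    (n : 'I_N.+1 -> 'cV[R]_N) : R :=
  if row_free (normal_matrix n)^T
  then signed_volume
         (xget (fun _ => 0) [set u | is_dual_simplex n u]%classic)
  else 0.

(* The volume of the piece associated to vertex j of the face opposite i. *)
Definition vertex_piece (R : realType) (N : nat) (v : 'I_N.+1 -> 'cV[R]_N)
    (C : 'cV[R]_N) (j i : 'I_N.+1) : R :=
  if i == j then 0
  else ((N - 1)%:R)^-1 *
       \sum_(k | (k != i) && (k != j))
         half_edge_length v C j k * dual_volume v C j k [set~ i].

(* Main.v *)
Require Import Defs.
From mathcomp Require Import all_boot all_order all_algebra.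
From mathcomp Require Import boolp classical_sets reals.
From mathcomp Require Import ring lra.

(* With L the Laplacian and V = (v_1 - v_0, ..., v_N - v_0), the definition of
   the normals says n = V L_00^T, which is (a). For (b), n_i is - N |Vol T#|
   times the gradient of the i-th barycentric coordinate of T#, so det n is
   (- N |Vol T#|)^N / (N! Vol T#).

   For (c), write a signed dual length as (C - C_t) . e / |e|, where e is the
   altitude onto t of the remaining vertex. The dual volumes and the pieces of
   faces are then volumes of cones over those of the facets, and induction on
   the dimension gives two facts: the pieces of a face sum to its volume (the
   barycentric coordinates of the center sum to 1), and
   n_j = sum_i (A_{j,i} / h_i) e_i, the divergence theorem for the piece of T
   at j, in whose proof the two facets that share a given face of codimension 2
   contribute opposite quarter turns of the same vector. The latter says that A,
   rescaled by the heights h_i and multiplied by the matrix of the barycentric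
   coordinates, has the n_j as upper part of its columns; adding all columns to
   the first one, where the n_j cancel and the last entries sum to N |Vol T|,
   computes its determinant. *)

Set Implicit Arguments.
Unset Strict Implicit.
Unset Printing Implicit Defensive.

Import Order.TTheory GRing.Theory Num.Theory.
Local Open Scope ring_scope.

(** * Inner product, Euclidean norm and a Gram-Schmidt step *)

Section InnerProduct.
Variables (R : realType) (N : nat).
Implicit Types (x y z : 'cV[R]_N) (a : R).

Lemma dotvE x y : dotv x y = \sum_k x k ord0 * y k ord0.
Proof. by rewrite /dotv mxE; apply: eq_bigr => k _; rewrite mxE. Qed.

Lemma dotvC x y : dotv x y = dotv y x.
Proof. by rewrite !dotvE; apply: eq_bigr => k _; rewrite mulrC. Qed.

Lemma dotvDl x y z : dotv (x + y) z = dotv x z + dotv y z.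
Proof. by rewrite /dotv linearD mulmxDl mxE. Qed.

Lemma dotvZl a x y : dotv (a *: x) y = a * dotv x y.
Proof. by rewrite /dotv linearZ -scalemxAl mxE. Qed.

Lemma dotvNl x y : dotv (- x) y = - dotv x y.
Proof. by rewrite -scaleN1r dotvZl mulN1r. Qed.

Lemma dotvBl x y z : dotv (x - y) z = dotv x z - dotv y z.
Proof. by rewrite dotvDl dotvNl. Qed.

Lemma dotvDr x y z : dotv x (y + z) = dotv x y + dotv x z.
Proof. by rewrite !(dotvC x) dotvDl. Qed.

Lemma dotvZr a x y : dotv x (a *: y) = a * dotv x y.
Proof. by rewrite !(dotvC x) dotvZl. Qed.

Lemma dotvNr x y : dotv x (- y) = - dotv x y.
Proof. by rewrite !(dotvC x) dotvNl. Qed.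

Lemma dotvBr x y z : dotv x (y - z) = dotv x y - dotv x z.
Proof. by rewrite !(dotvC x) dotvBl. Qed.

Lemma dotv0r x : dotv x 0 = 0.
Proof. by rewrite -(subrr 0) dotvBr subrr. Qed.

Lemma dotv0l x : dotv 0 x = 0.
Proof. by rewrite dotvC dotv0r. Qed.

Lemma dotv_sumr (I : finType) (P : pred I) (f : I -> 'cV[R]_N) x :
  dotv x (\sum_(i | P i) f i) = \sum_(i | P i) dotv x (f i).
Proof. exact: (big_morph _ (dotvDr x) (dotv0r x)). Qed.

Lemma dotv_suml (I : finType) (P : pred I) (f : I -> 'cV[R]_N) x :
  dotv (\sum_(i | P i) f i) x = \sum_(i | P i) dotv (f i) x.
Proof. by rewrite dotvC dotv_sumr; apply: eq_bigr => i _; rewrite dotvC. Qed.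

Lemma dotv_ge0 x : 0 <= dotv x x.
Proof. by rewrite dotvE sumr_ge0 // => k _; rewrite -expr2 sqr_ge0. Qed.

Lemma dotv_eq0 x : (dotv x x == 0) = (x == 0).
Proof.
apply/eqP/eqP => [|->]; last by rewrite dotv0r.
rewrite dotvE => /psumr_eq0P H; apply/colP => k; rewrite mxE.
have/eqP := H (fun i _ => sqr_ge0 (x i ord0)) k isT.
by rewrite -expr2 sqrf_eq0 => /eqP.
Qed.

Lemma sqr_enorm x : enorm x ^+ 2 = dotv x x.
Proof. exact/sqr_sqrtr/dotv_ge0. Qed.

Lemma enorm_ge0 x : 0 <= enorm x.
Proof. exact: sqrtr_ge0. Qed.

Lemma enorm_eq0 x : (enorm x == 0) = (x == 0).
Proof. by rewrite -sqrf_eq0 sqr_enorm dotv_eq0. Qed.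

Lemma enormZ a x : enorm (a *: x) = `|a| * enorm x.
Proof.
by rewrite /enorm dotvZl dotvZr mulrA -expr2 sqrtrM ?sqr_ge0 // sqrtr_sqr.
Qed.

Lemma enormN x : enorm (- x) = enorm x.
Proof. by rewrite -scaleN1r enormZ normrN1 mul1r. Qed.

Lemma dotv_gram_schmidt x y : dotv x (y - (dotv y x / dotv x x) *: x) = 0.
Proof.
rewrite dotvBr dotvZr; have [->|x0] := eqVneq x 0.
  by rewrite !dotv0l mulr0 subrr.
by rewrite divfK ?dotv_eq0 // dotvC subrr.
Qed.

(** Base times height is the area of the parallelogram spanned by [x] and [y]. The right-hand side
    is symmetric in the two vectors, which is what [turned_center_antisym] uses. *)
Lemma sqr_enorm_gram_schmidt x y (z := y - (dotv y x / dotv x x) *: x) :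
  x != 0 -> (enorm x * enorm z) ^+ 2 = dotv x x * dotv y y - dotv x y ^+ 2.
Proof.
move=> x0; rewrite exprMn !sqr_enorm {1}/z dotvBl dotvZl dotv_gram_schmidt.
rewrite mulr0 subr0 dotvBr dotvZr (dotvC y x).
move: x0; rewrite -dotv_eq0; move: (dotv x x) (dotv x y) (dotv y y) => a b c a0.
by field.
Qed.

End InnerProduct.

Local Opaque dotv enorm.

(** * Orthogonal projections and signed dual lengths *)

Section Projections.
Variables (R : realType) (N : nat) (v : 'I_N.+1 -> 'cV[R]_N).
Implicit Types (s t : {set 'I_N.+1}) (x p q : 'cV[R]_N).

Lemma affine_span_vertex s k : k \in s -> affine_span v s (v k).
Proof.
move=> ks; exists (fun i => (i == k)%:R); split.
  by rewrite (bigD1 k) //= eqxx big1 ?addr0 // => i /andP[_ /negPf ->].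
rewrite (bigD1 k) //= eqxx scale1r big1 ?addr0 // => i /andP[_ /negPf ->].
by rewrite scale0r.
Qed.

Lemma affine_span_translate s p q q' (a : R) :
  affine_span v s p -> affine_span v s q -> affine_span v s q' ->
  affine_span v s (p + a *: (q - q')).
Proof.
move=> [c [c1 ->]] [d [d1 ->]] [d' [d'1 ->]].
exists (fun i => c i + a * (d i - d' i)); split.
  by rewrite big_split /= -mulr_sumr sumrB c1 d1 d'1 subrr mulr0 addr0.
rewrite -sumrB scaler_sumr -big_split /=; apply: eq_bigr => i _.
by rewrite -scalerBl scalerA scalerDl.
Qed.

Lemma affine_span_sub s t : s \subset t ->
  forall p, affine_span v s p -> affine_span v t p.
Proof.
move=> /finset.setIidPr st p [c [c1 ->]].
exists (fun i => if i \in s then c i else 0); split.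
  by rewrite -big_mkcondr -c1; apply: eq_bigl => i; rewrite -finset.in_setI st.
under [RHS]eq_bigr => i do rewrite (fun_if (fun a => a *: v i)) scale0r.
by rewrite -big_mkcondr; apply: eq_bigl => i; rewrite -finset.in_setI st.
Qed.

Lemma affine_span_notin t k : affinely_independent v -> k \notin t ->
  ~ affine_span v t (v k).
Proof.
move=> hv kt [c [c1 cE]].
pose d i := (if i \in t then c i else 0) - (i == k)%:R.
have d0 : \sum_i d i = 0.
  rewrite sumrB -big_mkcond c1 (bigD1 k) //= eqxx big1 ?addr0 ?subrr //.
  by move=> i /negPf ->.
have dv : \sum_i d i *: v i = 0.
  under eq_bigr => i do rewrite scalerBl (fun_if (fun a => a *: v i)) scale0r.
  rewrite sumrB -big_mkcond -cE (bigD1 k) //= eqxx big1 ?addr0.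
    by rewrite scale1r subrr.
  by move=> i /negPf ->; rewrite scale0r.
have := hv d d0 dv k; rewrite /d (negPf kt) eqxx sub0r => /eqP.
by rewrite oppr_eq0 oner_eq0.
Qed.

Lemma orthogonal_affine_span s x p :
  (forall k, k \in s -> dotv x (v k - p) = 0) ->
  forall q, affine_span v s q -> dotv x (q - p) = 0.
Proof.
move=> H q [c [c1 ->]].
have -> : \sum_(i in s) c i *: v i - p = \sum_(i in s) c i *: (v i - p).
  under [RHS]eq_bigr => i do rewrite scalerBr.
  by rewrite sumrB -scaler_suml c1 scale1r.
by rewrite dotv_sumr big1 // => i si; rewrite dotvZr H // mulr0.
Qed.

Lemma orthogonal_projection_unique s x p q :
  is_orthogonal_projection (affine_span v s) x p ->
  is_orthogonal_projection (affine_span v s) x q -> p = q.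
Proof.
move=> [sp Hp] [sq Hq]; apply/eqP; rewrite -subr_eq0 -dotv_eq0.
have := Hp _ sq; have := Hq _ sp; rewrite !(dotvBl, dotvBr).
rewrite !(dotvC q) !(dotvC x) => h1 h2; apply/eqP; lra.
Qed.

(** The vector [e] is orthogonal to the directions of [t] and spans, together with them, the
    directions of [k |: t]. Hence it suffices to correct [p] by the component of [x - p] along
    [e]. *)
Lemma orthogonal_projectionU1 t k x p q (e := v k - q) :
  is_orthogonal_projection (affine_span v t) x p ->
  is_orthogonal_projection (affine_span v t) (v k) q ->
  is_orthogonal_projection (affine_span v (k |: t)) x
    (p + (dotv (x - p) e / dotv e e) *: e).
Proof.
move=> [tp Hp] [tq Hq]; set c := _ / _.
(* For [e = 0] the quotient [c] is 0 by convention, and both sides vanish. *)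
have ce : c * dotv e e = dotv (x - p) e.
  have [e0|e0] := eqVneq (dotv e e) 0; last by rewrite divfK.
  have/eqP := e0; rewrite dotv_eq0 => /eqP ->.
  by rewrite !dotv0r mulr0.
have st : t \subset k |: t by apply: finset.subsetUr.
have eqp : dotv e (q - p) = 0.
  by rewrite -opprB dotvNr Hq // oppr0.
have H : forall l, l \in k |: t ->
    dotv (x - (p + c *: e)) (v l - (p + c *: e)) = 0.
  have xe : dotv (x - (p + c *: e)) e = 0.
    by rewrite opprD addrA dotvBl dotvZl ce subrr.
  move=> l; rewrite finset.in_setU1 => /orP[/eqP ->|lt].
    have -> : v k - (p + c *: e) = (q - p) + (1 - c) *: e.
      by rewrite scalerBl scale1r {2}/e; apply/colP => i; rewrite !mxE; ring.
    rewrite dotvDr dotvZr xe mulr0 addr0.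
    by rewrite opprD addrA dotvBl dotvZl eqp mulr0 subr0 Hp.
  have -> : v l - (p + c *: e) = (v l - p) - c *: e by rewrite opprD addrA.
  rewrite dotvBr dotvZr xe mulr0 subr0.
  rewrite opprD addrA dotvBl dotvZl Hp; last exact: affine_span_vertex.
  have -> : v l - p = (v l - q) + (q - p) by rewrite addrA subrK.
  by rewrite dotvDr eqp Hq ?addr0 ?mulr0 ?subr0 //; apply: affine_span_vertex.
split; last exact: orthogonal_affine_span.
apply: affine_span_translate; [exact: affine_span_sub tp| |].
  by apply: affine_span_vertex; rewrite finset.setU11.
exact: affine_span_sub tq.
Qed.

(** Induction on the cardinality, with [x] generalized: the step projects both [x] and the removed
    vertex onto the smaller flat. *)
Lemma orthogonal_projection_exists s x : s != finset.set0 ->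
  exists p, is_orthogonal_projection (affine_span v s) x p.
Proof.
have [m] := ubnP #|s|; elim: m s x => // m IH s x sm /finset.set0Pn[k ks].
have [s0|s0] := eqVneq (s :\ k) finset.set0; last first.
  have lt : (#|s :\ k| < m)%N by rewrite (cardsD1 k) ks in sm.
  have [p Hp] := IH _ x lt s0; have [q Hq] := IH _ (v k) lt s0.
  rewrite -(finset.setD1K ks).
  by eexists; apply: orthogonal_projectionU1 Hp Hq.
have sE : s = [set k] by rewrite -(finset.setD1K ks) s0 finset.setU0.
exists (v k); split; first exact: affine_span_vertex.
apply: orthogonal_affine_span => l; rewrite sE finset.in_set1 => /eqP ->.
by rewrite subrr dotv0r.
Qed.

Lemma subsimplex_centerP s x : s != finset.set0 ->
  is_orthogonal_projection (affine_span v s) x (subsimplex_center v x s).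
Proof.
move=> s0; have [p Hp] := orthogonal_projection_exists x s0.
exact: (xgetPex 0 (ex_intro _ p Hp)).
Qed.

Lemma subsimplex_center_unique s x p : s != finset.set0 ->
  is_orthogonal_projection (affine_span v s) x p ->
  subsimplex_center v x s = p.
Proof.
by move=> s0; apply: orthogonal_projection_unique; apply: subsimplex_centerP.
Qed.

Lemma subsimplex_center1 x k : subsimplex_center v x [set k] = v k.
Proof.
apply: subsimplex_center_unique; first by apply/finset.set0Pn; exists k; rewrite finset.set11.
split; first by apply: affine_span_vertex; rewrite finset.set11.
apply: orthogonal_affine_span => l; rewrite finset.in_set1 => /eqP ->.
by rewrite subrr dotv0r.
Qed.

Local Opaque subsimplex_center.

Definition altitude t k := v k - subsimplex_center v (v k) t.

Lemma subsimplex_centerU1 t k x : t != finset.set0 ->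
  subsimplex_center v x (k |: t) = subsimplex_center v x t +
    (dotv (x - subsimplex_center v x t) (altitude t k) /
     dotv (altitude t k) (altitude t k)) *: altitude t k.
Proof.
move=> t0; apply: subsimplex_center_unique.
  by apply/finset.set0Pn; exists k; rewrite finset.setU11.
by apply: orthogonal_projectionU1; apply: subsimplex_centerP.
Qed.

Lemma altitude1 j k : altitude [set j] k = v k - v j.
Proof. by rewrite /altitude subsimplex_center1. Qed.

(** A Gram-Schmidt step: [altitude t b] loses its component along [altitude t a], the direction by
    which the flat grows. *)
Lemma altitudeU1 t a b : t != finset.set0 ->
  altitude (a |: t) b = altitude t b -
    (dotv (altitude t b) (altitude t a) /
     dotv (altitude t a) (altitude t a)) *: altitude t a.
Proof.
by move=> t0; rewrite {1}/altitude subsimplex_centerU1 // opprD addrA.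
Qed.

Lemma affine_span_center s x : s != finset.set0 ->
  affine_span v s (subsimplex_center v x s).
Proof. by move=> /(subsimplex_centerP x)[]. Qed.

Lemma dotv_center_span s x p q : s != finset.set0 ->
  affine_span v s p -> affine_span v s q ->
  dotv (x - subsimplex_center v x s) (p - q) = 0.
Proof.
move=> /(subsimplex_centerP x)[_ H] sp sq.
have -> : p - q = (p - subsimplex_center v x s) - (q - subsimplex_center v x s).
  by rewrite opprB addrA subrK.
by rewrite dotvBr !H ?subrr.
Qed.

Lemma dotv_altitude_span t k p q : t != finset.set0 ->
  affine_span v t p -> affine_span v t q -> dotv (altitude t k) (p - q) = 0.
Proof. exact: dotv_center_span. Qed.

Lemma dotv_altitude_apex t k p : t != finset.set0 -> affine_span v t p ->
  dotv (altitude t k) (v k - p) = dotv (altitude t k) (altitude t k).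
Proof.
move=> t0 tp; have -> : v k - p = altitude t k + (subsimplex_center v (v k) t - p).
  by rewrite addrA subrK.
rewrite dotvDr dotv_altitude_span ?addr0 //; exact: affine_span_center.
Qed.

Lemma altitude_neq0 t k : affinely_independent v -> t != finset.set0 ->
  k \notin t -> altitude t k != 0.
Proof.
move=> hv t0 kt; apply/eqP => /eqP; rewrite subr_eq0 => /eqP vE.
by apply: (affine_span_notin hv kt); rewrite vE; apply: affine_span_center.
Qed.

Lemma enorm_altitude_gt0 t k : affinely_independent v -> t != finset.set0 ->
  k \notin t -> 0 < enorm (altitude t k).
Proof. by move=> *; rewrite lt0r enorm_ge0 enorm_eq0 altitude_neq0. Qed.

Local Opaque altitude.

Definition signed_dual_length (C : 'cV[R]_N) t k : R :=
  dotv (C - subsimplex_center v C t) (altitude t k) / enorm (altitude t k).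

Lemma center_diff C t k : affinely_independent v -> t != finset.set0 ->
  k \notin t ->
  subsimplex_center v C (k |: t) - subsimplex_center v C t =
  (signed_dual_length C t k / enorm (altitude t k)) *: altitude t k.
Proof.
move=> hv t0 kt; rewrite subsimplex_centerU1 // addrC addKr.
by rewrite /signed_dual_length -mulrA -invfM -expr2 sqr_enorm.
Qed.

(** On the segment from the center to [v k], the height above [t] is affine and runs from the signed
    dual length to the positive length of the altitude; it avoids 0 exactly when it starts above
    0. *)
Lemma same_side_center C t k : affinely_independent v -> t != finset.set0 ->
  k \notin t ->
  same_side (affine_span v t) (subsimplex_center v C (k |: t)) (v k) <->
  0 < signed_dual_length C t k.
Proof.
move=> hv t0 kt; set h := signed_dual_length C t k.
set e := altitude t k; set p := subsimplex_center v C t.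
set q := subsimplex_center v (v k) t; set n := enorm e.
have n0 : 0 < n by apply: enorm_altitude_gt0.
have tp : affine_span v t p by apply: affine_span_center.
have tq : affine_span v t q by apply: affine_span_center.
have cE : subsimplex_center v C (k |: t) = p + (h / n) *: e.
  by rewrite -center_diff // addrC subrK.
have segE a : subsimplex_center v C (k |: t) +
    a *: (v k - subsimplex_center v C (k |: t)) =
    (p + a *: (q - p)) + ((1 - a) * (h / n) + a) *: e.
  by rewrite cE; apply/colP => i; rewrite !mxE; ring.
have tseg a : affine_span v t (p + a *: (q - p)) by apply: affine_span_translate.
split=> [H|h0 a /andP[a0 a1]].
  (* The parameter at which the height vanishes; it lies in [0, 1] because [h <= 0 < n]. *)
  rewrite ltNge; apply/negP => h0; pose a := (- h) / (n - h).
  have nh : 0 < n - h by lra.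
  have a01 : 0 <= a <= 1.
    by rewrite /a divr_ge0 ?ler_pdivrMr //=; lra.
  have := H a a01; rewrite segE.
  have -> : (1 - a) * (h / n) + a = 0.
    by rewrite /a; field; rewrite !gt_eqF.
  by rewrite scale0r addr0.
rewrite segE => /(dotv_altitude_span k t0 (tseg a)).
rewrite opprD addrA subrr sub0r dotvNr dotvZr -/e.
have ee : 0 < dotv e e by rewrite -sqr_enorm exprn_gt0.
have hn : 0 < h / n by apply: divr_gt0.
move/eqP; rewrite oppr_eq0 mulf_eq0 (gt_eqF ee) orbF => /eqP.
have [->|] := eqVneq a 0; first by lra.
move=> an; have ap : 0 < a by rewrite lt0r an.
have : 0 <= (1 - a) * (h / n) by rewrite mulr_ge0 //; lra.
lra.
Qed.

(** The centers differ by a multiple of the altitude, of length the absolute value of the signed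
    dual length, and [same_side_center] gives the sign. If the center lies in the span of [t], the
    side test fails, but the distance is 0. *)
Lemma dual_length_signed C t k : affinely_independent v -> t != finset.set0 ->
  k \notin t -> dual_length v C t (k |: t) = signed_dual_length C t k.
Proof.
move=> hv t0 kt; rewrite /dual_length.
have n0 := enorm_altitude_gt0 hv t0 kt.
have dE : enorm (subsimplex_center v C (k |: t) - subsimplex_center v C t) =
    `|signed_dual_length C t k|.
  rewrite center_diff // enormZ normrM [X in _ * X * _]ger0_norm ?divfK ?gt_eqF //.
  by rewrite invr_ge0 ltW.
rewrite dE.
have kE : (k |: t) :\: t = [set k].
  rewrite finset.setDUl finset.setDv finset.setU0; apply/finset.setDidPl.
  by rewrite disjoints1.
rewrite kE; case: asboolP => [|H].
  move=> /(_ k); rewrite finset.set11 => /(_ isT) /(same_side_center C hv t0 kt) h0.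
  by rewrite gtr0_norm.
rewrite ler0_norm ?opprK // leNgt; apply/negP => /(same_side_center C hv t0 kt) h.
by apply: H => l; rewrite finset.in_set1 => /eqP ->.
Qed.

(** A half edge is the dual length of a vertex in an edge, so the inductions on pieces of faces can
    start from vertices. *)
Lemma half_edge_length_signed C j k : affinely_independent v -> j != k ->
  half_edge_length v C j k = signed_dual_length C [set j] k.
Proof.
move=> hv jk; have t0 : [set j] != finset.set0.
  by apply/finset.set0Pn; exists j; rewrite finset.set11.
have kt : k \notin [set j] by rewrite finset.in_set1 eq_sym.
have := center_diff C hv t0 kt; rewrite subsimplex_center1 finset.setUC => E.
have n0 := enorm_altitude_gt0 hv t0 kt.
rewrite /half_edge_length E -altitude1 dotvZl -sqr_enorm; field.
by rewrite gt_eqF.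
Qed.

(* In the plane orthogonal to t this is, up to orientation, the quarter turn of
   the vector from the center of t to C. *)
Lemma turned_center C t a b : affinely_independent v ->
  t != finset.set0 -> a \notin t ->
  (signed_dual_length C (a |: t) b / enorm (altitude t a)) *: altitude t a -
  (signed_dual_length C t a / enorm (altitude (a |: t) b)) *:
    altitude (a |: t) b =
  (enorm (altitude t a) * enorm (altitude (a |: t) b))^-1 *:
  (dotv (C - subsimplex_center v C t) (altitude t b) *: altitude t a -
   dotv (C - subsimplex_center v C t) (altitude t a) *: altitude t b).
Proof.
move=> hv t0 at_.
rewrite /signed_dual_length subsimplex_centerU1 // opprD addrA altitudeU1 //.
move: (C - _) (altitude t a) (altitude t b) => c x y.
rewrite (dotvBl c) dotvZl dotv_gram_schmidt mulr0 subr0 dotvBr dotvZr.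
move: (enorm _) (enorm x) => n m.
by apply/colP => i; rewrite !mxE invfM; ring.
Qed.

(** In the formula of [turned_center] the vector is antisymmetric in [a] and [b], while the scalar
    is the inverse of the area of the parallelogram spanned by the two altitudes over [t], which is
    symmetric. *)
Lemma turned_center_antisym C t a b : affinely_independent v ->
  t != finset.set0 -> a \notin t -> b \notin t ->
  (signed_dual_length C (a |: t) b / enorm (altitude t a)) *: altitude t a -
  (signed_dual_length C t a / enorm (altitude (a |: t) b)) *:
    altitude (a |: t) b =
  - ((signed_dual_length C (b |: t) a / enorm (altitude t b)) *: altitude t b -
     (signed_dual_length C t b / enorm (altitude (b |: t) a)) *:
       altitude (b |: t) a).
Proof.
move=> hv t0 at_ bt; rewrite !turned_center // !altitudeU1 //.
have := altitude_neq0 hv t0 at_; have := altitude_neq0 hv t0 bt.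
move: (C - _) (altitude t a) (altitude t b) => c x y y0 x0.
suff -> : enorm x * enorm (y - (dotv y x / dotv x x) *: x) =
          enorm y * enorm (x - (dotv x y / dotv y y) *: y).
  by rewrite -[RHS]scalerN opprB.
apply/eqP; rewrite -(eqrXn2 (n := 2)) ?mulr_ge0 ?enorm_ge0 //.
by rewrite !sqr_enorm_gram_schmidt // mulrC (dotvC x).
Qed.

End Projections.

Local Opaque subsimplex_center altitude.

(** * Dual volumes as sums over chains *)

Section Chains.
Variables (R : realType) (N : nat) (v : 'I_N.+1 -> 'cV[R]_N) (C : 'cV[R]_N).
Variables (i j : 'I_N.+1).
Implicit Types (s t : {set 'I_N.+1}) (k : 'I_N.+1).

(** The pointwise condition on dimensions becomes an equality of sequences, which splits along
    [rcons]. *)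
Lemma is_chain_iota s m (c : m.-tuple {set 'I_N.+1}) :
  is_chain i j s c =
  [&& head finset.set0 c == [set i; j], last finset.set0 c == s,
      sorted (fun t u : {set 'I_N.+1} => t \subset u) c &
      map (@Defs.dim N) c == iota 1 m].
Proof.
rewrite /is_chain; congr [&& _, _, _ & _].
apply/forallP/eqP => [H|H r].
  apply: (@eq_from_nth _ 0%N); rewrite size_map size_tuple ?size_iota // => r rm.
  rewrite (nth_map finset.set0) ?size_tuple // nth_iota //.
  by have/eqP := H (Ordinal rm); rewrite (tnth_nth finset.set0).
rewrite (tnth_nth finset.set0) -(nth_map _ 0%N) ?size_tuple //.
by rewrite H nth_iota.
Qed.

Lemma is_chain_rcons s m (c : m.+1.-tuple {set 'I_N.+1}) :
  is_chain i j s (rcons_tuple c s) =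
  [&& is_chain i j (last finset.set0 c) c, last finset.set0 c \subset s
    & Defs.dim s == m.+2].
Proof.
have iotaS : iota 1 m.+2 = rcons (iota 1 m.+1) m.+2.
  by rewrite -[m.+2]addn1 iotaD cats1 addn1.
rewrite !is_chain_iota iotaS map_rcons eqseq_rcons last_rcons !eqxx.
case/tupleP: c => x c; move: (map _ _ == _) (_ == m.+2) => b1 b2.
rewrite /= rcons_path.
by case: (x == _) => //=; case: path => //=; rewrite andbCA.
Qed.

Lemma is_chain_dim s m (c : m.+1.-tuple {set 'I_N.+1}) :
  is_chain i j s c -> Defs.dim s = m.+1.
Proof.
rewrite is_chain_iota => /and4P[_ /eqP <- _ /eqP].
case/tupleP: c => x c /(congr1 (last 0%N)).
by rewrite -[m.+1 in RHS]addn1 iotaD cats1 last_rcons add1n /= last_map.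
Qed.

Lemma is_chain_sub s m (c : m.+1.-tuple {set 'I_N.+1}) :
  is_chain i j s c -> [set i; j] \subset s.
Proof.
rewrite is_chain_iota => /and4P[/eqP <- /eqP <- H _].
case/tupleP: c H => x c /=; elim: {c}(tval c) x => //= y c IH x /andP[xy /IH].
exact: fintype.subset_trans.
Qed.

(** The length [m] is kept apart from the dimension of [s], so that the latter can be rewritten
    without casting tuples. *)
Definition chain_sum s m : R :=
  \sum_(c : m.-tuple {set 'I_N.+1} | is_chain i j s c)
    \prod_(r < m.-1) dual_length v C (nth finset.set0 c r) (nth finset.set0 c r.+1).

Lemma is_chain_last s m (c : m.-tuple {set 'I_N.+1}) :
  is_chain i j s c -> last finset.set0 c = s.
Proof. by rewrite is_chain_iota => /and4P[_ /eqP]. Qed.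

(** Chains are sorted by their last set before [s], which is [s] without one vertex outside the
    edge. *)
Lemma chain_sumS s m : [set i; j] \subset s -> Defs.dim s = m.+2 ->
  chain_sum s m.+2 = \sum_(k in s :\: [set i; j])
    chain_sum (s :\ k) m.+1 * dual_length v C (s :\ k) s.
Proof.
move=> ijs ds; have cs : #|s| = m.+3 by move: ds; rewrite /Defs.dim; case: #|s| => //= ? ->.
(* Dropping the last set is inverse to appending [s]. *)
pose belastt (c : m.+2.-tuple {set 'I_N.+1}) : m.+1.-tuple {set 'I_N.+1} :=
  belast_tuple (thead c) (behead_tuple c).
rewrite /chain_sum (reindex_onto (fun c => rcons_tuple c s) belastt) /=; last first.
  move=> c /and4P[_ /eqP sE _ _]; apply: val_inj => /=.
  by case/tupleP: c sE => x c /= <-; rewrite theadE -lastI.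
have PE (c : m.+1.-tuple {set 'I_N.+1}) :
    is_chain i j s (rcons_tuple c s) && (belastt (rcons_tuple c s) == c) =
    is_chain i j (last finset.set0 c) c && (last finset.set0 c \subset s).
  have -> : belastt (rcons_tuple c s) == c.
    apply/eqP/val_inj; case/tupleP: c => x c /=.
    rewrite /thead (tnth_nth x) /=; elim: (tval c) x => //= y c' IH x; congr cons.
    exact: IH.
  by rewrite is_chain_rcons ds eqxx !andbT.
rewrite (eq_bigl _ _ PE).
(* The candidates for the last set before [s]: the facets of [s] that contain the edge. *)
pose Q t := [&& [set i; j] \subset t, t \subset s & Defs.dim t == m.+1].
rewrite (partition_big (fun c : m.+1.-tuple _ => last finset.set0 c) Q) /=; last first.
  move=> c /andP[cc cs']; rewrite /Q cs' (is_chain_sub cc) (is_chain_dim cc).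
  exact: eqxx.
have QE : Q =1 [in [set s :\ k | k in s :\: [set i; j]]].
  move=> t; apply/and3P/imsetP => [[ijt ts /eqP dt]|[k kin ->]].
    have ct : #|t| = m.+2 by move: dt; rewrite /Defs.dim; case: #|t| => //= ? ->.
    have : #|s :\: t| == 1%N by rewrite cardsDS // cs ct subSnn.
    move=> /cards1P[k kE]; exists k; last first.
      by rewrite -kE finset.setDDr finset.setDv finset.set0U; apply/esym/finset.setIidPr.
    have : k \in s :\: t by rewrite kE finset.set11.
    rewrite !finset.in_setD => /andP[kt ->]; rewrite andbT.
    by apply: contra kt; apply: (fintype.subsetP ijt).
  move: kin; rewrite finset.in_setD => /andP[kij ks]; split.
  - by rewrite finset.subsetD1 kij ijs.
  - exact: finset.subD1set.
  by rewrite /Defs.dim; move: cs; rewrite (cardsD1 k) ks add1n => -[->].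
rewrite (eq_bigl _ _ QE) big_imset /=; last first.
  move=> k l; rewrite !finset.in_setD => /andP[_ ks] /andP[_ ls] /finset.setP /(_ k).
  by rewrite !finset.in_setD !finset.in_set1 ks eqxx andbT /=; case: eqP.
apply: eq_bigr => k kin; rewrite mulr_suml; apply: eq_big => [c|c /andP[_ /eqP cl]].
  have /and3P[_ sks _] : Q (s :\ k) by rewrite QE; apply: imset_f.
  by apply/andP/idP => [[/andP[cc _] /eqP <-]|cc] //; rewrite (is_chain_last cc) cc sks eqxx.
rewrite big_ord_recr /=; congr (_ * _).
  by apply: eq_bigr => r _; rewrite !nth_rcons size_tuple !ltnS ltn_ord ltnW.
rewrite !nth_rcons size_tuple ltnSn ltnn eqxx -cl.
by case/tupleP: c {cl} => x c; rewrite (last_nth finset.set0) /= size_tuple.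
Qed.

Lemma chain_sum1 : i != j -> chain_sum [set i; j] 1 = 1.
Proof.
move=> ij; rewrite /chain_sum (big_pred1 [tuple [set i; j]]).
  by rewrite big_ord0.
case/tupleP=> x c; rewrite is_chain_iota (tuple0 c) /=.
apply/andP/eqP => [[/eqP -> _] //|/(congr1 (fun c => thead c))].
by rewrite !theadE => ->; rewrite eqxx /Defs.dim cards2 ij.
Qed.

Lemma dual_volumeE s m : Defs.dim s = m.+1 ->
  dual_volume v C i j s = (m`!%:R)^-1 * chain_sum s m.+1.
Proof. by rewrite /dual_volume => ->. Qed.

Lemma dual_volume_edge : i != j -> dual_volume v C i j [set i; j] = 1.
Proof.
move=> ij; rewrite (@dual_volumeE _ 0) ?chain_sum1 ?mulr1 ?invr1 //.
by rewrite /Defs.dim cards2 ij.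
Qed.

(* The dual cell of the edge in s is the union of the cones over its dual cells
   in the facets of s that contain it. *)
Lemma dual_volume_cone s m : affinely_independent v ->
  [set i; j] \subset s -> Defs.dim s = m.+2 ->
  m.+1%:R * dual_volume v C i j s = \sum_(k in s :\: [set i; j])
    dual_volume v C i j (s :\ k) * signed_dual_length v C (s :\ k) k.
Proof.
move=> hv ijs ds; rewrite (dual_volumeE ds) chain_sumS // mulrA mulr_sumr.
apply: eq_bigr => k; rewrite finset.in_setD => /andP[kij ks].
have cs : #|s :\ k| = m.+2.
  by move: ds; rewrite /Defs.dim (cardsD1 k) ks add1n.
have s0 : s :\ k != finset.set0 by rewrite -card_gt0 cs.
have := dual_length_signed C hv s0 (negbT (finset.setD11 k s)).
rewrite finset.setD1K // => ->.
rewrite (@dual_volumeE _ m) ?factS; last by rewrite /Defs.dim cs.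
by rewrite natrM invfM !mulrA divff ?mul1r // pnatr_eq0.
Qed.

End Chains.

(** * Volumes and Gram determinants *)

Section GramMatrices.
Variables (R : realType) (N : nat).
Implicit Types (f : nat -> 'cV[R]_N) (m : nat).

Definition edge_gram f m : 'M[R]_m :=
  let E := \matrix_(k < m, l < N) (f k.+1 - f 0%N) l ord0 in E *m E^T.

(** A relative of the Cayley-Menger matrix, with inner products instead of squared distances. It
    treats all points alike, whereas [edge_gram] singles out [f 0]; this allows any point to be
    removed. *)
Definition bordered_gram f m : 'M[R]_m.+2 :=
  \matrix_(i, j) if (i == ord0) || (j == ord0) then (i != j)%:R
                 else dotv (f i.-1) (f j.-1).

Lemma edge_gramE f m i j :
  edge_gram f m i j = dotv (f i.+1 - f 0%N) (f j.+1 - f 0%N).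
Proof. by rewrite !mxE dotvE; apply: eq_bigr => k _; rewrite !mxE. Qed.

(** [edge_gram] is the Schur complement of the block [K] formed by the border and [f 0], and [K] has
    determinant -1. *)
Lemma det_bordered_gram f m : \det (bordered_gram f m) = - \det (edge_gram f m).
Proof.
pose K : 'M[R]_2 := \matrix_(i, j)
  if (i == ord0) || (j == ord0) then (i != j)%:R else dotv (f 0%N) (f 0%N).
pose X : 'M[R]_(m, 2) := \matrix_(i, j)
  if j == ord0 then dotv (f i.+1 - f 0%N) (f 0%N) else 1.
have -> : bordered_gram f m = block_mx 1%:M 0 X 1%:M *m
    block_mx K 0 0 (edge_gram f m) *m block_mx 1%:M X^T 0 1%:M :> 'M_(2 + m).
  rewrite !mulmx_block !(mul1mx, mulmx1, mul0mx, mulmx0, addr0, add0r).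
  have XK i j : (X *m K) i j = if j == ord0 then 1 else dotv (f i.+1) (f 0%N).
    rewrite mxE !big_ord_recl big_ord0 !mxE /=.
    by case: (unliftP ord0 j) => [j' ->|->] /=;
      rewrite ?(mulr0, mulr1, add0r, addr0, mul1r) // dotvBl subrK.
  have KX i j : (K *m X^T) i j = if i == ord0 then 1 else dotv (f j.+1) (f 0%N).
    rewrite mxE !big_ord_recl big_ord0 !mxE /=.
    by case: (unliftP ord0 i) => [i' ->|->] /=;
      rewrite ?(mul0r, mulr1, mul1r, add0r, addr0) // dotvBl subrK.
  apply/matrixP => i j; case: (@split_ordP 2 m i) => i' ->;
    case: (@split_ordP 2 m j) => j' ->.
  - rewrite block_mxEul !mxE -!val_eqE /=.
    by case: i' j' => [[|[|//]] ?] [[|[|//]] ?].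
  - rewrite block_mxEur KX mxE -!val_eqE /=.
    by case: i' => [[|[|//]] ?] //=; rewrite dotvC.
  - rewrite block_mxEdl XK mxE -!val_eqE /=.
    by case: j' => [[|[|//]] ?].
  rewrite block_mxEdr mxE [RHS]mxE [X in X + _]mxE edge_gramE.
  rewrite !big_ord_recl big_ord0 !XK !mxE /= !(dotvBl, dotvBr).
  rewrite (dotvC (f j'.+1)); ring.
rewrite !det_mulmx (@det_lblock _ 2 m) !(@det_ublock _ 2 m) !det1 !(mulr1, mul1r).
suff -> : \det K = -1 by rewrite mulN1r.
rewrite (expand_det_row K ord0) !big_ord_recl big_ord0 /cofactor !det_mx11.
by rewrite !mxE /= !(mul0r, add0r, addr0, expr1, mul1r, mulr1).
Qed.

(** The combination with coefficients [c] stands for the altitude from point [p]: its inner product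
    is [b] with every other point and [b + a] with [f p]. It yields a combination of rows of the
    matrix with a single nonzero entry. *)
Lemma det_bordered_gram_bump f m (p : nat) (c : nat -> R) (a b : R) :
  (p <= m.+1)%N -> c p = 1 -> \sum_(i < m.+2) c i = 0 ->
  (forall j, (j <= m.+1)%N ->
     dotv (\sum_(i < m.+2) c i *: f i) (f j) = b + (j == p)%:R * a) ->
  \det (bordered_gram f m.+1) =
  a * \det (bordered_gram (fun i => f (bump p i)) m).
Proof.
move=> pm cp c0 H; set B := bordered_gram f m.+1.
pose k : 'I_m.+3 := lift ord0 (Ordinal (pm : (p < m.+2)%N)).
(* The coefficient [- b] of the border row cancels the common inner product [b]. *)
pose u : 'rV[R]_m.+3 := \row_i if i == ord0 then - b else c i.-1.
have uB : u *m B = a *: delta_mx ord0 k.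
  apply/rowP => j; rewrite mxE big_ord_recl !mxE eqxx /=.
  rewrite (eq_bigr (fun i : 'I_m.+2 => c i * B (lift ord0 i) j)); last first.
    by move=> i _; rewrite !mxE.
  case: (unliftP ord0 j) => [j' ->|->] /=.
    rewrite mulr1 (eq_bigr (fun i : 'I_m.+2 => dotv (c i *: f i) (f j'))); last first.
      by move=> i _; rewrite !mxE dotvZl.
    rewrite -dotv_suml H ?leq_ord // addKr mulrC /k (inj_eq lift_inj).
    by rewrite -val_eqE.
  rewrite !mulr0 add0r (eq_bigr (fun i : 'I_m.+2 => c i)) ?c0 // => i _.
  by rewrite !mxE mulr1.
(* Multiplication by the adjugate turns the left side into the determinant, since entry [k] of [u]
   is [c p = 1], and the right side into [a] times a diagonal cofactor. *)
have := congr1 (fun M => (M *m \adj B) ord0 k) uB.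
rewrite -mulmxA mul_mx_adj mul_mx_scalar -scalemxAl -rowE !mxE /= cp mulr1 => ->.
rewrite /cofactor -signr_odd addnn odd_double mul1r; congr (_ * \det _).
apply/matrixP => i j; rewrite !mxE (inj_eq lift_inj) -!val_eqE /=.
(* Row [p.+1] of the matrix belongs to point [p], because the border occupies row 0. *)
have bumpE (q : 'I_m.+2) : (bump p.+1 q == 0%N) = (q == 0%N :> nat) /\
    ((q == 0%N :> nat) = false -> (bump p.+1 q).-1 = bump p q.-1).
  by case: q => -[|q] //= _; rewrite /bump /= ltnS; case: (p <= q)%N.
have [-> iE] := bumpE i; have [-> jE] := bumpE j.
by case: eqP iE => // _ ->//; case: eqP jE => // _ ->.
Qed.

Lemma det_edge_gram_bump f m (p : nat) (c : nat -> R) (a b : R) :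
  (p <= m.+1)%N -> c p = 1 -> \sum_(i < m.+2) c i = 0 ->
  (forall j, (j <= m.+1)%N ->
     dotv (\sum_(i < m.+2) c i *: f i) (f j) = b + (j == p)%:R * a) ->
  \det (edge_gram f m.+1) = a * \det (edge_gram (fun i => f (bump p i)) m).
Proof.
move=> pm cp c0 H; apply: oppr_inj.
by rewrite -mulrN -!det_bordered_gram; apply: det_bordered_gram_bump H.
Qed.

End GramMatrices.

Section Volumes.
Variables (R : realType) (N : nat) (v : 'I_N.+1 -> 'cV[R]_N).
Implicit Types (s t : {set 'I_N.+1}) (k : 'I_N.+1).

Lemma enum_setD1 (T : finType) (s : {set T}) (k : T) :
  enum (s :\ k) = rem k (enum s).
Proof.
rewrite rem_filter ?enum_uniq // /enum_mem -filter_predI.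
by apply: eq_filter => x; rewrite /= !inE.
Qed.

Lemma nth_rem (T : eqType) (x0 x : T) (s : seq T) i : x \in s ->
  nth x0 (rem x s) i = nth x0 s (bump (index x s) i).
Proof.
move=> xs; rewrite remE nth_cat size_take index_mem xs /bump.
case: ltnP => ip; first by rewrite nth_take // leqNgt ip.
by rewrite nth_drop addSn subnKC // leqNgt ltnNge ip.
Qed.

Definition listed_vertex s (i : nat) := v (nth ord0 (enum s) i).

Lemma subsimplex_volumeE s m : #|s| = m.+1 ->
  subsimplex_volume v s =
  Num.sqrt (\det (edge_gram (listed_vertex s) m)) / m`!%:R.
Proof. by rewrite /subsimplex_volume /Defs.dim => ->. Qed.

Lemma subsimplex_volume1 k : subsimplex_volume v [set k] = 1.
Proof.
by rewrite (@subsimplex_volumeE _ 0) ?cards1 // det_mx00 sqrtr1 divr1.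
Qed.

(** Base times height, squared. The altitude is [v k] minus an affine combination of the other
    vertices, so its coefficients sum to 0 with coefficient 1 at [k], as [det_edge_gram_bump]
    demands. *)
Lemma det_edge_gram_facet s k m : #|s| = m.+2 -> k \in s ->
  \det (edge_gram (listed_vertex s) m.+1) =
  dotv (altitude v (s :\ k) k) (altitude v (s :\ k) k) *
  \det (edge_gram (listed_vertex (s :\ k)) m).
Proof.
move=> cs ks; set t := s :\ k; set e := altitude v t k.
have ct : #|t| = m.+1 by move: cs; rewrite (cardsD1 k) ks add1n => -[].
have t0 : t != finset.set0 by rewrite -card_gt0 ct.
have se : size (enum s) = m.+2 by rewrite -cs cardE.
have [c [c1 cE]] := affine_span_center v (v k) t0.
pose d x := if x == k then 1 else - c x.
pose dn i := d (nth ord0 (enum s) i).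
have sum_listed (V : nmodType) (F : 'I_N.+1 -> V) :
    \sum_(i < m.+2) F (nth ord0 (enum s) i) = \sum_(x in s) F x.
  by rewrite -[RHS]big_enum (big_nth ord0 (r := enum s)) se big_mkord.
have dt (V : nmodType) (F : 'I_N.+1 -> V) :
    \sum_(x in s) F x = F k + \sum_(x in t) F x by rewrite (big_setD1 k).
have d0 : \sum_(i < m.+2) dn i = 0.
  rewrite (sum_listed _ d) dt /d eqxx.
  rewrite (eq_bigr (fun x => - c x)) ?sumrN ?c1 ?subrr // => x.
  by rewrite !finset.in_setD1 => /andP[/negPf -> _].
have dE : \sum_(i < m.+2) dn i *: listed_vertex s i = e.
  rewrite (sum_listed _ (fun x => d x *: v x)) dt /d eqxx scale1r.
  rewrite (eq_bigr (fun x => - (c x *: v x))) ?sumrN ?cE //; last first.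
    by move=> x; rewrite !finset.in_setD1 => /andP[/negPf -> _]; rewrite scaleNr.
  by rewrite -cE.
have ink : k \in enum s by rewrite mem_enum.
have pm : (index k (enum s) <= m.+1)%N by rewrite -ltnS -se index_mem.
have -> : listed_vertex t = (fun i => listed_vertex s (bump (index k (enum s)) i)).
  by apply: funext => i; rewrite /listed_vertex enum_setD1 nth_rem.
(* The altitude has the same inner product with every vertex of [t] as with its foot; at [v k] the
   excess is [dotv e e]. *)
apply: (@det_edge_gram_bump _ _ _ _ _ dn _ (dotv e (subsimplex_center v (v k) t))) => //.
  by rewrite /dn nth_index // /d eqxx.
move=> j jm; rewrite dE.
have js : (j < size (enum s))%N by rewrite se ltnS.
have -> : (j == index k (enum s)) = (nth ord0 (enum s) j == k).
  by apply/eqP/eqP => [->|<-]; rewrite ?nth_index // index_uniq ?enum_uniq.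
have ys : nth ord0 (enum s) j \in s by rewrite -mem_enum mem_nth.
rewrite /listed_vertex; move: (nth _ _ _) ys => y ys.
apply/eqP; rewrite addrC -subr_eq -dotvBr; apply/eqP.
have [->|yk] := eqVneq.
  by rewrite mul1r dotv_altitude_apex //; apply: affine_span_center.
rewrite mul0r dotv_altitude_span //; last exact: affine_span_center.
by apply: affine_span_vertex; rewrite finset.in_setD1 yk.
Qed.

Lemma subsimplex_volume_facet s k m : #|s| = m.+2 -> k \in s ->
  m.+1%:R * subsimplex_volume v s =
  enorm (altitude v (s :\ k) k) * subsimplex_volume v (s :\ k).
Proof.
move=> cs ks; have ct : #|s :\ k| = m.+1.
  by move: cs; rewrite (cardsD1 k) ks add1n => -[].
rewrite (subsimplex_volumeE cs) (subsimplex_volumeE ct).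
rewrite (det_edge_gram_facet cs ks) sqrtrM ?dotv_ge0 // factS natrM invfM.
have -> : Num.sqrt (dotv (altitude v (s :\ k) k) (altitude v (s :\ k) k)) =
  enorm (altitude v (s :\ k) k) by [].
rewrite mulrCA [m.+1%:R * _]mulrA divff ?pnatr_eq0 // mul1r mulrA; ring.
Qed.

Lemma subsimplex_volume_gt0 s : affinely_independent v -> s != finset.set0 ->
  0 < subsimplex_volume v s.
Proof.
move=> hv; rewrite -card_gt0; case cs: #|s| => [//|m] _.
elim: m s cs => [|m IH] s cs.
  by move/eqP/cards1P: cs => [k ->]; rewrite subsimplex_volume1.
have /card_gt0P[k ks] : (0 < #|s|)%N by rewrite cs.
have ct : #|s :\ k| = m.+1.
  by move: cs; rewrite (cardsD1 k) ks add1n => -[].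
rewrite -(@pmulr_rgt0 _ m.+1%:R) ?ltr0n // (subsimplex_volume_facet cs ks).
rewrite mulr_gt0 ?IH // enorm_altitude_gt0 ?finset.setD11 //.
by rewrite -card_gt0 ct.
Qed.

End Volumes.

(** * Pieces of faces *)

Section DualCells.
Variables (R : realType) (N : nat) (v : 'I_N.+1 -> 'cV[R]_N).
Hypothesis hv : affinely_independent v.
Variable C : 'cV[R]_N.
Implicit Types (s t : {set 'I_N.+1}) (j k l : 'I_N.+1).

(* A vertex is its own piece, with volume 1. *)
Definition vertex_volume j s : R :=
  if #|s| == 1%N then 1 else
  (#|s|.-1%:R)^-1 * \sum_(k in s :\ j)
    half_edge_length v C j k * dual_volume v C j k s.

Lemma edge_setD1 s j k : #|s| = 2 -> j \in s -> k \in s :\ j ->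
  s = [set j; k] /\ s :\ k = [set j].
Proof.
move=> cs js /setD1P[kj ks]; have sE : s = [set j; k].
  apply/esym/eqP; rewrite eqEcard cs cards2 eq_sym kj andbT.
  by apply/fintype.subsetP => x /set2P[] ->.
split=> //; rewrite sE; apply/finset.setP => x; rewrite !inE.
by have [->|] := eqVneq x k; rewrite ?(negPf kj) ?orbF.
Qed.

Lemma card_setD1 (T : finType) (s : {set T}) (k : T) m :
  k \in s -> #|s| = m.+1 -> #|s :\ k| = m.
Proof. by move=> ks; rewrite (cardsD1 k) ks add1n => -[]. Qed.

Lemma sum_pairs_exchange (V : nmodType) (A : {set 'I_N.+1})
    (F : 'I_N.+1 -> 'I_N.+1 -> V) :
  \sum_(k in A) \sum_(l in A :\ k) F k l =
  \sum_(l in A) \sum_(k in A :\ l) F k l.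
Proof.
rewrite (exchange_big_dep [in A]) /= => [|k l _ /setD1P[]//].
apply: eq_bigr => l lA; apply: eq_bigl => k.
by rewrite !finset.in_setD1 lA andbT eq_sym andbC.
Qed.

(** The piece at [j] is a signed union of cones over its pieces in the facets through [j]. Each dual
    volume is expanded into cones, and the edge end [k] is exchanged with the removed vertex [l]. *)
Lemma vertex_volume_cone j s m : #|s| = m.+2 -> j \in s ->
  m.+1%:R * vertex_volume j s =
  \sum_(k in s :\ j) vertex_volume j (s :\ k) * signed_dual_length v C (s :\ k) k.
Proof.
case: m => [|m] cs js; rewrite {1}/vertex_volume cs /=.
  rewrite invr1 !mul1r; apply: eq_bigr => k kj.
  have [sE skE] := edge_setD1 cs js kj; have [kNj _] := setD1P kj.
  rewrite skE /vertex_volume cards1 eqxx mul1r.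
  by rewrite half_edge_length_signed 1?eq_sym // sE dual_volume_edge ?mulr1 1?eq_sym.
rewrite mulrA divff ?pnatr_eq0 // mul1r.
have m0 : m.+1%:R != 0 :> R by rewrite pnatr_eq0.
apply: (mulfI m0); rewrite !mulr_sumr.
transitivity (\sum_(k in s :\ j) \sum_(l in s :\ j :\ k)
  half_edge_length v C j k * dual_volume v C j k (s :\ l) *
    signed_dual_length v C (s :\ l) l).
  apply: eq_bigr => k /setD1P[kj ks].
  rewrite mulrCA (@dual_volume_cone _ _ _ _ _ _ _ m) //; last first.
  - by rewrite /Defs.dim cs.
  - by apply/fintype.subsetP => x /set2P[] ->.
  rewrite mulr_sumr; apply: eq_big => [l|l _]; last by rewrite mulrA.
  by rewrite !inE negb_or andbA [(l != k) && _]andbC.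
rewrite sum_pairs_exchange; apply: eq_bigr => l /setD1P[lj ls].
have ct : #|s :\ l| = m.+2 by apply: card_setD1.
rewrite /vertex_volume ct /= [RHS]mulrA (mulrA m.+1%:R) divff // mul1r mulr_suml.
by apply: eq_bigl => k; rewrite !inE andbCA.
Qed.

(** Each summand is the barycentric coordinate at [k] of the center of [s]: its signed height above
    the opposite facet over that of [v k]. *)
Lemma subsimplex_barycentric_sum s m : #|s| = m.+2 ->
  \sum_(k in s) signed_dual_length v C (s :\ k) k /
                enorm (altitude v (s :\ k) k) = 1.
Proof.
move=> cs; have s0 : s != finset.set0 by rewrite -card_gt0 cs.
have [c [c1 cE]] := affine_span_center v C s0.
rewrite -c1; apply: eq_bigr => k ks.
have t0 : s :\ k != finset.set0 by rewrite -card_gt0 (card_setD1 ks cs).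
have kt : k \notin s :\ k by rewrite finset.setD11.
have := center_diff C hv t0 kt; rewrite finset.setD1K //.
set h := _ / _; set e := altitude v (s :\ k) k => /(congr1 (dotv e)).
set q := subsimplex_center v C (s :\ k).
have tq : affine_span v (s :\ k) q by apply: affine_span_center.
have -> : subsimplex_center v C s - q = \sum_(i in s) c i *: (v i - q).
  under eq_bigr => i do rewrite scalerBr.
  by rewrite sumrB -scaler_suml c1 scale1r -cE.
rewrite dotv_sumr (big_setD1 k) //= big1 ?addr0; last first.
  move=> l lt; rewrite dotvZr dotv_altitude_span ?mulr0 //.
  exact: affine_span_vertex.
rewrite dotvZr dotv_altitude_apex // dotvZr => H; apply/esym; move: H.
by apply: mulIf; rewrite dotv_eq0 altitude_neq0.
Qed.

(** By induction the pieces of a facet add up to the facet; the cone over it from the center of [s]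
    has as its share of the volume a barycentric coordinate, and these sum to 1. *)
Lemma sum_vertex_volume s : s != finset.set0 ->
  \sum_(j in s) vertex_volume j s = subsimplex_volume v s.
Proof.
rewrite -card_gt0; case cs: #|s| => [//|m] _; elim: m s cs => [|m IH] s cs.
  move/eqP/cards1P: (cs) => [k ->]; rewrite big_set1 subsimplex_volume1.
  by rewrite /vertex_volume cards1.
have m0 : m.+1%:R != 0 :> R by rewrite pnatr_eq0.
apply: (mulfI m0); rewrite mulr_sumr.
under eq_bigr => j js do rewrite vertex_volume_cone //.
rewrite sum_pairs_exchange -[RHS]mulr1.
rewrite -[X in _ = _ * X](subsimplex_barycentric_sum cs) mulr_sumr.
apply: eq_bigr => k ks; rewrite -mulr_suml IH; last exact: card_setD1.
have t0 : s :\ k != finset.set0 by rewrite -card_gt0 (card_setD1 ks cs).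
have := enorm_altitude_gt0 hv t0 (negbT (finset.setD11 k s)).
rewrite (subsimplex_volume_facet v cs ks).
move: (enorm _) (subsimplex_volume _ _) => n V n0; field.
by rewrite gt_eqF.
Qed.

Lemma eq_oppr_eq0 (x : 'cV[R]_N) : x = - x -> x = 0.
Proof.
move/eqP; rewrite -addr_eq0 -mulr2n -scaler_nat scaler_eq0 pnatr_eq0 /=.
by move/eqP.
Qed.

Lemma sum_pairs_antisym (A : {set 'I_N.+1})
    (F : 'I_N.+1 -> 'I_N.+1 -> 'cV[R]_N) :
  (forall k l, k \in A -> l \in A -> k != l -> F k l = - F l k) ->
  \sum_(k in A) \sum_(l in A :\ k) F k l = 0.
Proof.
move=> H; set S := LHS; apply: eq_oppr_eq0.
rewrite {1}/S sum_pairs_exchange -sumrN; apply: eq_bigr => k kA.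
rewrite -sumrN; apply: eq_bigr => l /setD1P[lk lA]; exact: H.
Qed.

(* The divergence theorem for the piece of s at j: its boundary consists of the
   dual cells of the edges at j and of the pieces of the facets at j. *)
Lemma vertex_piece_divergence j s m : #|s| = m.+2 -> j \in s ->
  \sum_(k in s :\ j) (dual_volume v C j k s / edge_length v j k) *: (v k - v j) =
  \sum_(k in s :\ j) (vertex_volume j (s :\ k) / enorm (altitude v (s :\ k) k)) *:
    altitude v (s :\ k) k.
Proof.
elim: m s => [|m IH] s cs js.
  apply: eq_bigr => k kj.
  have [sE skE] := edge_setD1 cs js kj; have [kNj _] := setD1P kj.
  rewrite skE altitude1 /vertex_volume cards1 eqxx sE dual_volume_edge //.
  by rewrite eq_sym.
have m0 : m.+1%:R != 0 :> R by rewrite pnatr_eq0.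
apply: (scalerI m0); rewrite !scaler_sumr.
(* Dual volumes are expanded into cones over the facets omitting [l], and the induction hypothesis
   is applied inside each of these facets. *)
transitivity (\sum_(l in s :\ j) \sum_(k in s :\ j :\ l)
  signed_dual_length v C (s :\ l) l *:
    ((vertex_volume j (s :\ l :\ k) / enorm (altitude v (s :\ l :\ k) k)) *:
       altitude v (s :\ l :\ k) k)).
  transitivity (\sum_(k in s :\ j) \sum_(l in s :\ j :\ k)
    signed_dual_length v C (s :\ l) l *:
      ((dual_volume v C j k (s :\ l) / edge_length v j k) *: (v k - v j))).
    apply: eq_bigr => k /setD1P[kj ks].
    rewrite scalerA mulrA (@dual_volume_cone _ _ _ _ _ _ _ m) //; last first.
    - by rewrite /Defs.dim cs.
    - by apply/fintype.subsetP => x /set2P[] ->.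
    rewrite mulr_suml scaler_suml; apply: eq_big => [l|l _].
      by rewrite !inE negb_or andbA [(l != k) && _]andbC.
    by rewrite scalerA; congr (_ *: _); ring.
  rewrite sum_pairs_exchange; apply: eq_bigr => l /setD1P[lj ls].
  have sE : s :\ j :\ l = s :\ l :\ j by apply/finset.setP => k; rewrite !inE andbCA.
  rewrite -!scaler_sumr sE IH //; first exact: card_setD1.
  by rewrite !inE eq_sym lj js.
apply/eqP; rewrite -subr_eq0; apply/eqP.
have -> : \sum_(l in s :\ j) m.+1%:R *:
    ((vertex_volume j (s :\ l) / enorm (altitude v (s :\ l) l)) *:
       altitude v (s :\ l) l) =
  \sum_(l in s :\ j) \sum_(k in s :\ j :\ l)
    (vertex_volume j (s :\ l :\ k) * signed_dual_length v C (s :\ l :\ k) k /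
     enorm (altitude v (s :\ l) l)) *: altitude v (s :\ l) l.
  apply: eq_bigr => l /setD1P[lj ls].
  have sE : s :\ j :\ l = s :\ l :\ j by apply/finset.setP => k; rewrite !inE andbCA.
  rewrite scalerA mulrA vertex_volume_cone //; last first.
  - by rewrite !inE eq_sym lj js.
  - exact: card_setD1.
  by rewrite sE mulr_suml scaler_suml.
rewrite -sumrB; under eq_bigr => l _ do rewrite -sumrB.
(* Both orders of removing [k] and [l] lead to the same face [r], whose piece at [j] is a common
   factor; what remains is the vector of [turned_center_antisym]. *)
apply: sum_pairs_antisym => k l /setD1P[kj ks] /setD1P[lj ls] kl.
set r := s :\ k :\ l.
have rE : s :\ l :\ k = r by apply/finset.setP => x; rewrite !inE andbCA.
have lr : s :\ k = l |: r by rewrite finset.setD1K // !inE eq_sym kl.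
have kr : s :\ l = k |: r by rewrite -rE finset.setD1K // !inE kl.
have jr : j \in r by rewrite !inE ![j == _]eq_sym kj lj.
have r0 : r != finset.set0 by apply/finset.set0Pn; exists j.
have kNr : k \notin r by rewrite !inE eqxx andbF.
have lNr : l \notin r by rewrite !inE eqxx.
have factor (q a n d n' : R) (x y : 'cV[R]_N) :
    a *: ((q / n) *: x) - (q * d / n') *: y = q *: ((a / n) *: x - (d / n') *: y).
  by apply/colP => i; rewrite !mxE; ring.
by rewrite rE lr kr !factor (turned_center_antisym C hv r0 lNr kNr) scalerN.
Qed.

End DualCells.

(** * Signed volumes and dual simplices *)

Section EdgeMatrix.
Variables (R : realType) (N : nat) (v : 'I_N.+1 -> 'cV[R]_N).
Implicit Types (i j k : 'I_N.+1).

Definition edge_matrix : 'M[R]_N :=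
  \matrix_(l, k) (v (lift ord0 k) - v ord0) l ord0.

Definition homogeneous_matrix : 'M[R]_N.+1 :=
  \matrix_(k < N.+1, j < N.+1)
    (if unlift ord_max k is Some l then v j l ord0 else 1).

(** Right multiplication by this unitriangular matrix adds all other columns to the first one. *)
Definition column_sum_mx : 'M[R]_N.+1 :=
  \matrix_(i, j) ((i == j) || (j == ord0))%:R.

Lemma det_column_sum_mx : \det column_sum_mx = 1.
Proof.
rewrite det_trig; last first.
  apply/is_trig_mxP => i j ij; rewrite mxE -!val_eqE /=.
  by rewrite (ltn_eqF ij) gtn_eqF // (leq_ltn_trans _ ij).
by rewrite big1 // => i _; rewrite mxE eqxx.
Qed.

Lemma mul_column_sum_mx m (A : 'M[R]_(m, N.+1)) (i : 'I_m) j :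
  (A *m column_sum_mx) i j = if j == ord0 then \sum_k A i k else A i j.
Proof.
rewrite mxE; case: eqVneq => [->|j0].
  by apply: eq_bigr => k _; rewrite mxE orbT mulr1.
rewrite (bigD1 j) //= mxE eqxx mulr1 big1 ?addr0 // => k kj.
by rewrite mxE (negPf kj) (negPf j0) mulr0.
Qed.

Lemma det_homogeneous_matrix :
  \det homogeneous_matrix = (-1) ^+ N * \det edge_matrix.
Proof.
(* The homogeneous matrix after subtracting its first column from the others: the last row becomes
   (1, 0, ..., 0), and expanding along it gives the sign. *)
pose M : 'M[R]_N.+1 := \matrix_(k, j)
  if unlift ord_max k is Some l
  then (if j == ord0 then v ord0 else v j - v ord0) l ord0 else (j == ord0)%:R.
have -> : homogeneous_matrix = (column_sum_mx *m M^T)^T.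
  apply/matrixP => k j; rewrite mxE [RHS]mxE mxE.
  rewrite (eq_bigr (fun i => ((j == i) || (i == ord0))%:R * M k i)); last first.
    by move=> i _; rewrite !mxE.
  have [->|j0] := eqVneq j ord0.
    rewrite (bigD1 ord0) //= big1 ?addr0 => [|i i0]; last first.
      by rewrite eq_sym (negPf i0) mul0r.
    by rewrite !mxE eqxx mul1r; case: unliftP => // l _.
  rewrite (bigD1 ord0) //= (bigD1 j) //= big1 ?addr0 => [|i /andP[i0 ij]]; last first.
    by rewrite eq_sym (negPf i0) (negPf ij) mul0r.
  rewrite !eqxx orbT /= !mul1r !mxE eqxx (negPf j0).
  by case: unliftP => [l _|_]; rewrite ?addr0 // !mxE addrC subrK.
rewrite det_tr det_mulmx det_column_sum_mx mul1r det_tr.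
rewrite (expand_det_row M ord_max) (bigD1 ord0) //= big1 ?addr0 => [|i i0]; last first.
  by rewrite mxE unlift_none (negPf i0) mul0r.
rewrite mxE unlift_none eqxx mul1r /cofactor /= addn0; congr (_ * \det _).
by apply/matrixP => l k; rewrite !mxE liftK /= !mxE.
Qed.

Lemma signed_volumeE : signed_volume v = \det edge_matrix / N`!%:R.
Proof.
rewrite /signed_volume -/homogeneous_matrix det_homogeneous_matrix.
by rewrite mulrAC mulrA -exprMn mulrNN mulr1 expr1n mul1r.
Qed.

Lemma subsimplex_volume_setT :
  subsimplex_volume v [set: 'I_N.+1] = `|signed_volume v|.
Proof.
rewrite (@subsimplex_volumeE _ _ _ _ N) ?cardsT ?card_ord // signed_volumeE.
have -> : edge_gram (listed_vertex v [set: 'I_N.+1]) N =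
    edge_matrix^T *m edge_matrix^T^T.
  have E (i : 'I_N.+1) : listed_vertex v [set: 'I_N.+1] i = v i.
    by rewrite /listed_vertex enum_setT -enumT nth_ord_enum.
  apply/matrixP => i j; rewrite edge_gramE (E (lift ord0 i)) (E (lift ord0 j)) (E ord0).
  by rewrite mxE dotvE; apply: eq_bigr => k _; rewrite !mxE.
rewrite det_mulmx !det_tr -expr2 sqrtr_sqr normrM normfV.
by rewrite [`|N`!%:R|]ger0_norm.
Qed.

Hypothesis hv : affinely_independent v.

Lemma signed_volume_neq0 : signed_volume v != 0.
Proof.
rewrite -normr_gt0 -subsimplex_volume_setT subsimplex_volume_gt0 //.
by apply/finset.set0Pn; exists ord0.
Qed.

Lemma edge_matrix_unit : edge_matrix \in unitmx.
Proof.
have := signed_volume_neq0; rewrite signed_volumeE mulf_eq0 negb_or => /andP[].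
by rewrite unitmxE unitfE.
Qed.

Lemma facet_volume_altitude i : (0 < N)%N ->
  enorm (altitude v [set~ i] i) * subsimplex_volume v [set~ i] =
  N%:R * `|signed_volume v|.
Proof.
move=> N0; have cT : #|[set: 'I_N.+1]| = N.-1.+2 by rewrite cardsT card_ord prednK.
have := subsimplex_volume_facet v cT (finset.in_setT i).
by rewrite finset.setTD subsimplex_volume_setT prednK.
Qed.

Lemma orthogonal_to_edges i (x : 'cV[R]_N) :
  (forall j, dotv x (v j - v i) = 0) -> x = 0.
Proof.
move=> H; have : x^T *m edge_matrix = 0.
  apply/rowP => j; rewrite [RHS]mxE -[RHS](subrr 0) -{1}(H (lift ord0 j)) -(H ord0).
  rewrite -dotvBr opprB addrA subrK dotvE mxE; apply: eq_bigr => k _.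
  by rewrite !mxE.
move=> /(congr1 (mulmx^~ (invmx edge_matrix))).
rewrite mulmxK ?edge_matrix_unit // mul0mx => /(congr1 trmx).
by rewrite trmxK trmx0.
Qed.

(** Such an [x] is an outward normal of the facet opposite [i], hence a negative multiple of the
    altitude, which points towards [v i]. *)
Lemma facet_normal_enorm i (x : 'cV[R]_N) (s : R) : (0 < N)%N -> 0 < s ->
  (forall j, j != i -> dotv x (v j - v i) = s) ->
  enorm x * enorm (altitude v [set~ i] i) = s.
Proof.
move=> N0 s0 H; set e := altitude v [set~ i] i.
have t0 : [set~ i] != finset.set0 by rewrite -card_gt0 cardsC1 card_ord.
have kt : i \notin [set~ i] by rewrite !inE eqxx.
have n0 := enorm_altitude_gt0 hv t0 kt; rewrite -/e in n0.
have -> : x = - (s / dotv e e) *: e.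
  apply/eqP; rewrite scaleNr -subr_eq0 opprK; apply/eqP.
  apply: (@orthogonal_to_edges i) => j; rewrite dotvDl dotvZl.
  have [->|ji] := eqVneq j i; first by rewrite subrr !dotv0r mulr0 addr0.
  have tj : affine_span v [set~ i] (v j) by apply: affine_span_vertex; rewrite !inE.
  rewrite H // -[v j - v i]opprB dotvNr (dotv_altitude_apex i t0 tj) mulrN.
  by rewrite divfK ?subrr // -sqr_enorm expf_neq0 // gt_eqF.
rewrite enormZ normrN -sqr_enorm ger0_norm ?divr_ge0 ?ltW // ?exprn_gt0 //.
by rewrite -mulrA -expr2 divfK // expf_neq0 // gt_eqF.
Qed.

End EdgeMatrix.

Section DualSimplex.
Variables (R : realType) (N : nat).
Implicit Types (n u : 'I_N.+1 -> 'cV[R]_N).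

(** Intermediate values of ['X^m - a%:P] between 0 and [1 + a]. *)
Lemma root_exists (a : R) m : (0 < m)%N -> 0 < a ->
  exists2 s : R, 0 < s & s ^+ m = a.
Proof.
move=> m0 a0; have H0 : ('X^m - a%:P).[0] <= 0 <= ('X^m - a%:P).[1 + a].
  rewrite !hornerE expr0n gtn_eqF // sub0r oppr_le0 ltW //= subr_ge0.
  have le1 : 1 <= 1 + a by rewrite lerDl ltW.
  by apply: le_trans (ler_eXnr m0 le1); rewrite lerDr.
have a1 : 0 <= 1 + a by rewrite addr_ge0 // ltW.
have [s /andP[s0 _]] := poly_ivt a1 H0.
rewrite rootE !hornerE subr_eq0 => /eqP sE; exists s => //.
rewrite lt0r s0 andbT; apply/eqP => s00; move: sE a0; rewrite s00 => <-.
by rewrite expr0n gtn_eqF // ltxx.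
Qed.

(** Facet volume times altitude is [N] times the unsigned volume, so the transposed normals times
    the edges of [u] form a scalar matrix. The absolute value in that scalar is the source of the
    factor [Num.sg]. *)
Lemma det_dual_simplex_normals n u : (0 < N)%N -> is_dual_simplex n u ->
  (-1) ^+ N * \det (normal_matrix n) =
  Num.sg (signed_volume u) ^+ N * (N%:R ^+ N * signed_volume u ^+ (N - 1)) / N`!%:R.
Proof.
move=> N0 [hu H]; set V := signed_volume u.
have V0 : V != 0 by apply: signed_volume_neq0.
have nE i j : j != i -> dotv (n i) (u j - u i) = N%:R * `|V|.
  move=> ji; have [H1 H2 H3] := H i.
  rewrite -(@facet_normal_enorm _ _ _ hu i (n i) _ N0 (H2 j ji)) => [|k ki].
    by rewrite H3 mulrC facet_volume_altitude.
  apply/eqP; rewrite -subr_eq0 -dotvBr opprB addrA subrK; apply/eqP; exact: H1.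
have n0 i j : j != i -> i != ord0 -> dotv (n i) (u j - u ord0) = 0.
  by move=> ji i0; have [H1 _ _] := H i; apply: H1; rewrite // eq_sym.
have nU : (normal_matrix n)^T *m edge_matrix u = (- (N%:R * `|V|))%:M.
  apply/matrixP => i j.
  transitivity (dotv (n (lift ord0 i)) (u (lift ord0 j) - u ord0)).
    by rewrite mxE dotvE; apply: eq_bigr => k _; rewrite !mxE.
  rewrite mxE; have [->|ij] := eqVneq i j.
    by rewrite -opprB dotvNr nE // eq_sym lift_eqF.
  by rewrite n0 // ?(inj_eq lift_inj) 1?eq_sym // lift_eqF.
have DE : \det (normal_matrix n) * \det (edge_matrix u) =
    (-1) ^+ N * (N%:R ^+ N * (Num.sg V ^+ N * V ^+ N)).
  rewrite -det_tr -det_mulmx nU det_scalar -[- (_ * _)]mulN1r [`|V|]normrEsg.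
  by rewrite (exprMn _ (-1)) (exprMn _ N%:R) (exprMn _ (Num.sg V)).
have V0' : N`!%:R != 0 :> R by rewrite pnatr_eq0 -lt0n fact_gt0.
have UE : \det (edge_matrix u) = N`!%:R * V.
  by rewrite /V signed_volumeE mulrC divfK.
have D : \det (normal_matrix n) =
    (-1) ^+ N * (N%:R ^+ N * (Num.sg V ^+ N * V ^+ N)) / (N`!%:R * V).
  by rewrite -DE UE mulfK // mulf_neq0.
have VN : V ^+ N = V ^+ (N - 1) * V by rewrite -exprSr subn1 prednK.
have sq (e A B : R) : e ^+ 2 = 1 -> e * (e * A / B) = A / B.
  by move=> e2; rewrite !mulrA -expr2 e2 mul1r.
rewrite D VN sq ?sqrr_sign //.
move: (V ^+ (N - 1)) (Num.sg V ^+ N) (N%:R ^+ N) (V) V0 => a b c W W0; field.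
by rewrite V0' W0.
Qed.

Lemma dual_simplex_exists n : (1 < N)%N -> \sum_i n i = 0 ->
  row_free (normal_matrix n)^T -> exists u, is_dual_simplex n u.
Proof.
move=> N1 nsum nfree; have N0 := ltnW N1; set D := \det (normal_matrix n).
have Du : (normal_matrix n)^T \in unitmx by rewrite -row_free_unit.
have D0 : D != 0 by move: Du; rewrite unitmx_tr unitmxE unitfE.
have N0R : 0 < N%:R :> R by rewrite ltr0n.
have f0 : 0 < N`!%:R :> R by rewrite ltr0n fact_gt0.
(* The number [s] is to be [N] times the volume of the dual simplex. The vertices below give it
   volume [s ^+ N] over N! times the absolute value of [D], whence this equation for [s]. *)
have [||s s0 sE] := @root_exists (N`!%:R * `|D| / N%:R) N.-1.
- by rewrite -ltnS prednK.
- by rewrite divr_gt0 ?mulr_gt0 ?normr_gt0.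
pose U : 'M[R]_N := - s *: invmx (normal_matrix n)^T.
pose u i : 'cV[R]_N := if unlift ord0 i is Some j then col j U else 0.
have u0 : u ord0 = 0 by rewrite /u unlift_none.
have uS j : u (lift ord0 j) = col j U by rewrite /u liftK.
have UE : edge_matrix u = U.
  by apply/matrixP => l k; rewrite mxE u0 subr0 uS mxE.
have nU : (normal_matrix n)^T *m U = (- s)%:M.
  by rewrite -scalemxAr mulmxV // scalemx1.
have nu i j : dotv (n (lift ord0 i)) (u (lift ord0 j)) = - s *+ (i == j).
  move/matrixP/(_ i j): nU; rewrite [RHS]mxE => <-.
  by rewrite mxE dotvE uS; apply: eq_bigr => k _; rewrite !mxE.
have nlift i j : dotv (n (lift ord0 i)) (u j) = - s *+ (lift ord0 i == j).
  have [k ->|->] := unliftP ord0 j; first by rewrite nu (inj_eq lift_inj).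
  by rewrite u0 dotv0r eq_sym (negPf (neq_lift _ _)).
have n0 : n ord0 = - \sum_j n (lift ord0 j).
  by move: nsum; rewrite big_ord_recl => /eqP; rewrite addr_eq0 => /eqP.
(* Since the normals sum to 0, the index 0 behaves like the others. *)
have nuE i j : dotv (n i) (u j - u i) = s *+ (j != i).
  have [k ->|->] := unliftP ord0 i.
    rewrite dotvBr !nlift eqxx eq_sym opprK.
    by case: eqVneq => _; rewrite ?addNr ?add0r.
  rewrite u0 subr0 n0 dotvNl dotv_suml.
  have [k ->|->] := unliftP ord0 j; last first.
    by rewrite u0 big1 ?oppr0 ?eqxx // => k _; rewrite dotv0r.
  rewrite (bigD1 k) //= nu eqxx big1 ?addr0 ?opprK; last first.
    by move=> l lk; rewrite nu (negPf lk).
  by [].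
have Uunit : U \in unitmx.
  by rewrite unitmxZ ?unitmx_inv // unitfE oppr_eq0 gt_eqF.
have hu : affinely_independent u.
  move=> c c0 cu; have cl j : c (lift ord0 j) = 0.
    have : dotv (n (lift ord0 j)) (\sum_i c i *: u i) = 0 by rewrite cu dotv0r.
    rewrite dotv_sumr (bigD1 (lift ord0 j)) //= big1 ?addr0 => [|i ij]; last first.
      by rewrite dotvZr nlift eq_sym (negPf ij) mulr0.
    by rewrite dotvZr nlift eqxx => /eqP; rewrite mulf_eq0 oppr_eq0 (gt_eqF s0) orbF => /eqP.
  move=> i; have [j ->|->] := unliftP ord0 i; first exact: cl.
  by move: c0; rewrite big_ord_recl big1 ?addr0.
exists u; split=> // i; split=> [j k ji ki|j ji|].
- have -> : u k - u j = (u k - u i) - (u j - u i) by rewrite opprB addrA subrK.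
  by rewrite dotvBr !nuE ji ki subrr.
- by rewrite nuE ji.
have nE : enorm (n i) * enorm (altitude u [set~ i] i) = s.
  by apply: facet_normal_enorm => // j ji; rewrite nuE ji.
have h0 : enorm (altitude u [set~ i] i) != 0.
  by apply/eqP => h0; move: nE s0; rewrite h0 mulr0 => <-; rewrite ltxx.
apply: (mulIf h0); rewrite nE mulrC facet_volume_altitude //.
rewrite signed_volumeE UE detZ normrM normfV (ger0_norm (ltW f0)) normrM normrX normrN.
rewrite (gtr0_norm s0) det_inv det_tr -/D normfV.
have sN : s ^+ N = s * s ^+ N.-1 by rewrite -exprS prednK.
by rewrite sN sE; field; rewrite normr_eq0 D0 !gt_eqF.
Qed.

End DualSimplex.

(** * The Laplacian determinant *)

Section Laplacian.
Variables (R : realType) (N : nat) (v : 'I_N.+1 -> 'cV[R]_N) (C : 'cV[R]_N).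
Implicit Types (i j k : 'I_N.+1).

Lemma weight_sym i j : weight v C i j = weight v C j i.
Proof.
rewrite /weight /edge_length -(enormN (v i - v j)) opprB; congr (_ / _).
rewrite /dual_volume; congr (_ * _); apply: eq_bigl => c.
by rewrite /is_chain finset.setUC.
Qed.

Lemma sum_vertex_normal : \sum_i vertex_normal v C i = 0.
Proof.
set S := LHS; apply: eq_oppr_eq0.
rewrite {1}/S /vertex_normal (exchange_big_dep xpredT) //= -sumrN.
apply: eq_bigr => j _; rewrite -sumrN; apply: eq_big => [i|i _].
  by rewrite eq_sym.
by rewrite weight_sym -scalerN opprB.
Qed.

(** The rows of the Laplacian sum to 0, so the base point [v i] of the differences may be replaced
    by [v ord0]. *)
Lemma vertex_normal_laplacian i :
  vertex_normal v C i =
  \sum_(j < N) laplacian v C i (lift ord0 j) *: (v (lift ord0 j) - v ord0).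
Proof.
transitivity (\sum_j laplacian v C i j *: (v j - v ord0)); last first.
  by rewrite big_ord_recl subrr scaler0 add0r.
rewrite [RHS](bigD1 i) //= mxE eqxx scaleNr scaler_suml addrC -sumrB.
by apply: eq_bigr => j ji; rewrite mxE eq_sym (negPf ji) -scalerBr opprB addrA subrK.
Qed.

Lemma normal_matrix_laplacian :
  normal_matrix (vertex_normal v C) =
  edge_matrix v *m (row' ord0 (col' ord0 (laplacian v C)))^T.
Proof.
apply/matrixP => k j; rewrite mxE vertex_normal_laplacian summxE mxE.
by apply: eq_bigr => i _; rewrite mxE mulrC; congr (_ * _); rewrite !mxE.
Qed.

Hypothesis hv : affinely_independent v.

Lemma laplacian_determinant_normals :
  laplacian_determinant v C =
  (-1) ^+ N * \det (normal_matrix (vertex_normal v C)) /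
  (N`!%:R * signed_volume v).
Proof.
have f0 : N`!%:R != 0 :> R by rewrite pnatr_eq0 -lt0n fact_gt0.
have VE : N`!%:R * signed_volume v = \det (edge_matrix v).
  by rewrite signed_volumeE mulrC divfK.
have d0 : \det (edge_matrix v) != 0 by rewrite -VE mulf_neq0 // signed_volume_neq0.
rewrite /laplacian_determinant -scaleN1r detZ normal_matrix_laplacian VE.
by rewrite det_mulmx det_tr (mulrC (\det _)) mulrA mulfK.
Qed.

Lemma vertex_pieceE i j : (1 < N)%N -> i != j ->
  vertex_piece v C j i = vertex_volume v C j [set~ i].
Proof.
move=> N1 ij; rewrite /vertex_piece /vertex_volume (negPf ij) cardsC1 card_ord /=.
rewrite gtn_eqF // subn1; congr (_ * _); apply: eq_bigl => k.
by rewrite !inE andbC.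
Qed.

Lemma sum_vertex_piece i : (1 < N)%N ->
  \sum_j vertex_piece v C j i = subsimplex_volume v [set~ i].
Proof.
move=> N1; have t0 : [set~ i] != finset.set0.
  by rewrite -card_gt0 cardsC1 card_ord ltnW.
rewrite -(sum_vertex_volume hv C t0) (bigD1 i) //= {1}/vertex_piece eqxx add0r.
apply: eq_big => j; first by rewrite !inE.
by move=> ji; rewrite vertex_pieceE // eq_sym.
Qed.

Lemma vertex_normal_pieces j : (1 < N)%N ->
  vertex_normal v C j = \sum_i
    (vertex_piece v C j i / enorm (altitude v [set~ i] i)) *: altitude v [set~ i] i.
Proof.
move=> N1; have cT : #|[set: 'I_N.+1]| = N.-1.+2.
  by rewrite cardsT card_ord prednK // ltnW.
have H := vertex_piece_divergence hv C cT (finset.in_setT j).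
rewrite [RHS](bigD1 j) //= {1}/vertex_piece eqxx mul0r scale0r add0r.
transitivity (\sum_(k in [set: 'I_N.+1] :\ j)
    (dual_volume v C j k [set: 'I_N.+1] / edge_length v j k) *: (v k - v j)).
  by apply: eq_bigl => k; rewrite !inE andbT.
rewrite H; apply: eq_big => k; first by rewrite !inE andbT.
by rewrite !inE andbT finset.setTD => kj; rewrite vertex_pieceE.
Qed.

(* The columns hold the coefficients of the barycentric coordinates, the linear
   part above and the constant term in the last row. *)
Definition barycentric_matrix : 'M[R]_N.+1 :=
  let g i := (dotv (altitude v [set~ i] i) (altitude v [set~ i] i))^-1 *:
             altitude v [set~ i] i in
  \matrix_(k, i)
    (if unlift ord_max k is Some l then g i l ord0 else 1 - dotv (g i) (v i)).

(** The affine function of column [i] is 1 at [v i] and 0 on the opposite facet, as the altitude is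
    divided by its squared length. *)
Lemma barycentric_matrixP : (0 < N)%N ->
  barycentric_matrix^T *m homogeneous_matrix v = 1%:M.
Proof.
move=> N0; apply/matrixP => i j; rewrite mxE (bigD1_ord ord_max) //=.
set e := altitude v [set~ i] i.
have t0 : [set~ i] != finset.set0 by rewrite -card_gt0 cardsC1 card_ord.
have kt : i \notin [set~ i] by rewrite !inE eqxx.
have e0 : dotv e e != 0 by rewrite dotv_eq0 altitude_neq0.
have -> : \sum_(l < N) barycentric_matrix^T i (lift ord_max l) *
    homogeneous_matrix v (lift ord_max l) j = dotv ((dotv e e)^-1 *: e) (v j).
  rewrite dotvE; apply: eq_bigr => l _; rewrite mxE.
  by rewrite [barycentric_matrix _ _]mxE [homogeneous_matrix v _ _]mxE liftK.
rewrite !mxE unlift_none mulr1 -/e !dotvZl.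
have [->|ij] := eqVneq i j; first by rewrite subrK.
have tj : affine_span v [set~ i] (v j).
  by apply: affine_span_vertex; rewrite !inE eq_sym.
have := dotv_altitude_apex i t0 tj; rewrite dotvBr -/e => H.
rewrite -addrA -mulrN -mulrDr (_ : - _ + _ = - dotv e e) ?mulrN ?mulVf ?subrr //.
by rewrite -H opprB addrC.
Qed.

(** Barycentric coordinates sum to the constant function 1. This is read off from the product of the
    two inverse matrices in the other order. *)
Lemma sum_barycentric_constants : (0 < N)%N ->
  \sum_i barycentric_matrix ord_max i = 1.
Proof.
move=> N0; have /mulmx1C/matrixP/(_ ord_max ord_max) := barycentric_matrixP N0.
rewrite mxE [RHS]mxE eqxx mulr1n => <-; apply: eq_bigr => i _.
rewrite [homogeneous_matrix v _ _]mxE unlift_none mul1r.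
by rewrite [barycentric_matrix^T _ _]mxE.
Qed.

Lemma det_vertex_pieces : (1 < N)%N ->
  \det (\matrix_(i < N.+1, j < N.+1) vertex_piece v C j i) *
    \prod_i enorm (altitude v [set~ i] i) =
  N`!%:R * signed_volume v * (N%:R * `|signed_volume v|) *
    \det (normal_matrix (vertex_normal v C)).
Proof.
move=> N1; have N0 := ltnW N1.
set A := \matrix_(i, j) _; pose h i := enorm (altitude v [set~ i] i).
(* The linear part of a barycentric coordinate has a squared height in its denominator; the factor
   [h i] leaves the single height of [vertex_normal_pieces]. *)
pose P := barycentric_matrix *m (diag_mx (\row_i h i) *m A).
have PE k j : P k j = \sum_i barycentric_matrix k i * (h i * vertex_piece v C j i).
  by rewrite mxE; apply: eq_bigr => i _; rewrite mul_diag_mx !mxE.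
have Ptop l j : P (lift ord_max l) j = vertex_normal v C j l ord0.
  rewrite PE vertex_normal_pieces // summxE; apply: eq_bigr => i _.
  have scE (a : R) (x : 'cV[R]_N) : (a *: x) l ord0 = a * x l ord0 by rewrite mxE.
  rewrite [barycentric_matrix _ _]mxE liftK !scE /h -sqr_enorm.
  have h0 : enorm (altitude v [set~ i] i) != 0.
    rewrite gt_eqF // enorm_altitude_gt0 //; last by rewrite !inE eqxx.
    by rewrite -card_gt0 cardsC1 card_ord.
  move: (fun_of_matrix _ l ord0) (enorm _) h0 => x y y0.
  by field.
have S k : \sum_j P k j = if unlift ord_max k is Some l then 0
    else N%:R * `|signed_volume v|.
  case: unliftP => [l ->|->].
    rewrite (eq_bigr _ (fun j _ => Ptop l j)) -summxE.
    by rewrite sum_vertex_normal mxE.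
  under eq_bigr => j _ do rewrite PE.
  rewrite exchange_big /= -[RHS]mul1r.
  rewrite -[X in _ = X * _](sum_barycentric_constants N0) mulr_suml.
  apply: eq_bigr => i _; rewrite -mulr_sumr -mulr_sumr sum_vertex_piece //.
  by rewrite facet_volume_altitude.
(* Once all columns are added to the first, only its last entry is nonzero; the complementary minor
   has columns n_1, ..., n_N. *)
have detP : \det P = N%:R * `|signed_volume v| *
    ((-1) ^+ N * \det (normal_matrix (vertex_normal v C))).
  have -> : \det P = \det (P *m column_sum_mx R N).
    by rewrite [RHS]det_mulmx det_column_sum_mx mulr1.
  rewrite (expand_det_col _ ord0) (bigD1_ord ord_max) //= big1 ?addr0; last first.
    by move=> l _; rewrite mul_column_sum_mx eqxx S liftK mul0r.
  rewrite mul_column_sum_mx eqxx S unlift_none /cofactor addn0.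
  do 2![congr (_ * _)]; congr (\det _); apply/matrixP => l j.
  by rewrite 2!mxE mul_column_sum_mx eq_sym (negPf (neq_lift _ _)) Ptop mxE.
have Bdet : \det barycentric_matrix * ((-1) ^+ N * (N`!%:R * signed_volume v)) = 1.
  have := congr1 determinant (barycentric_matrixP N0).
  rewrite det_mulmx det_tr det1 det_homogeneous_matrix signed_volumeE.
  by rewrite [N`!%:R * _]mulrC divfK // pnatr_eq0 -lt0n fact_gt0.
have dE : \det P = \det barycentric_matrix * (\prod_i h i * \det A).
  rewrite !det_mulmx det_diag; congr (_ * (_ * _)).
  by apply: eq_bigr => i _; rewrite mxE.
have sg1 : (-1) ^+ N * (-1) ^+ N = 1 :> R by rewrite -expr2 sqrr_sign.
transitivity ((-1) ^+ N * (N`!%:R * signed_volume v) *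
    (\det barycentric_matrix * (\prod_i h i * \det A))).
  rewrite -[LHS]mul1r -[X in X * _ = _]Bdet; ring.
rewrite -dE detP; move: sg1; move: ((-1) ^+ N) (\det (normal_matrix _)) => e D ee.
transitivity (e * e * (N`!%:R * signed_volume v * (N%:R * `|signed_volume v|) * D)).
  by ring.
by rewrite ee mul1r.
Qed.

End Laplacian.

(* The factors Num.sg _ ^+ N are 1 unless N is odd and the volume is negative
   (they multiply 0 when the dual simplex is degenerate, as N - 1 > 0). For odd
   N the identities without them do not hold: exchanging two vertices of the
   simplex changes the sign of its volume and of the volume of its dual, and
   nothing else. *)
Theorem theorem4 (R : realType) (N : nat) (hN : (2 <= N)%N)
    (v : 'I_N.+1 -> 'cV[R]_N) (hv : affinely_independent v) (C : 'cV[R]_N) :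
  [/\ laplacian_determinant v C =
        (-1) ^+ N * \det (normal_matrix (vertex_normal v C)) /
        (N`!%:R * signed_volume v),
      laplacian_determinant v C =
        Num.sg (dual_simplex_volume (vertex_normal v C)) ^+ N *
        (N%:R ^+ N * dual_simplex_volume (vertex_normal v C) ^+ (N - 1) /
         (N`!%:R ^+ 2 * signed_volume v))
    & laplacian_determinant v C =
        Num.sg (signed_volume v) ^+ N *
        ((-1) ^+ N * N%:R ^+ N * signed_volume v ^+ (N - 2) *
         \det (\matrix_(i < N.+1, j < N.+1) vertex_piece v C j i) /
         (N`!%:R ^+ 2 * \prod_(i < N.+1) subsimplex_volume v [set~ i]))].
Proof.
have N0 := ltnW hN; have a := laplacian_determinant_normals C hv.
have f0 : N`!%:R != 0 :> R by rewrite pnatr_eq0 -lt0n fact_gt0.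
have V0 := signed_volume_neq0 hv.
set n := vertex_normal v C in a *; set V := signed_volume v in a V0 *.
split=> //; rewrite a.
  rewrite /dual_simplex_volume; case: ifP => nfree; last first.
    (* Degenerate dual simplex: its volume is 0 by definition, and both sides vanish. *)
    have -> : \det (normal_matrix n) = 0.
      move: nfree; rewrite row_free_unit unitmx_tr unitmxE unitfE.
      by move/negbFE/eqP.
    by rewrite sgr0 expr0n gtn_eqF // mulr0 !mul0r.
  have [u Hu] := dual_simplex_exists hN (sum_vertex_normal v C) nfree.
  rewrite (det_dual_simplex_normals N0 (xgetPex (fun=> 0) (ex_intro _ u Hu))).
  move: (signed_volume (xget _ _)) => W.
  by move: (Num.sg W ^+ N) (W ^+ (N - 1)) (N%:R ^+ N) => x y z; field; rewrite f0 V0.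
set D := \det (normal_matrix n); set A := \det (\matrix_(i, j) _).
pose h i := enorm (altitude v [set~ i] i).
pose F i := subsimplex_volume v [set~ i].
(* Trades the heights of [det_vertex_pieces] for the facet volumes of the statement. *)
have hF : \prod_i h i * \prod_i F i = (N%:R * `|V|) ^+ N.+1.
  rewrite -big_split /= (eq_bigr (fun=> N%:R * `|V|)) => [|i _].
    by rewrite prodr_const card_ord.
  exact: facet_volume_altitude.
have AD : A * \prod_i h i = N`!%:R * V * (N%:R * `|V|) * D.
  exact: det_vertex_pieces.
have F0 : \prod_i F i != 0.
  apply/prodf_neq0 => i _; rewrite gt_eqF // subsimplex_volume_gt0 //.
  by rewrite -card_gt0 cardsC1 card_ord.
have NV0 : N%:R * `|V| != 0.
  by rewrite mulf_neq0 ?normr_eq0 // pnatr_eq0 -lt0n.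
have DE : N`!%:R * V * D * \prod_i F i = A * (N%:R * `|V|) ^+ N.
  apply: (mulIf NV0); rewrite -[RHS]mulrA -exprSr -hF [RHS]mulrA AD; ring.
(* The square split off from the power of [V] cancels the [V] in this denominator and the one in
   (a). *)
have {}DE : D = A * (N%:R ^+ N * (Num.sg V ^+ N * (V ^+ (N - 2) * V ^+ 2))) /
                (N`!%:R * V * \prod_i F i).
  rewrite -exprD subnK // -exprMn -[Num.sg V * V]normrEsg -exprMn -DE.
  rewrite [_ * D * _]mulrAC [_ * D]mulrC mulfK //.
  by rewrite mulf_neq0 // mulf_neq0.
rewrite DE; move: F0; rewrite -/F; move: (\prod_i F i) => pF pF0.
move: ((-1) ^+ N) (Num.sg V ^+ N) (N%:R ^+ N) (V ^+ (N - 2)) => x y z w.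
by field; rewrite pF0 f0 V0.
Qed.
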